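(* Let $M$ be a connected manifold of class $C^2$, let $x\in M$, and let $E\to M$ be an orientable real $C^1$-vector bundle with standard fibre $\mathbb{R}^l$, equipped with a fixed orientation. Let $g\in C^1(M,\mathrm{S}^2E^* )$ be a bundle metric on $E$ and let $\nabla^g$ be a $C^0$-connection on $E$ that is compatible with $g$. Moreover, for each $k\in\mathbb{N}$, let $g_k\in C^1(M,\mathrm{S}^2E^* )$ be a bundle metric on $E$ and let $\nabla^k$ be a $C^0$-connection on $E$ compatible with $g_k$, such that $g_k|_x\to g|_x$ in $\mathrm{S}^2E_x^*$ and $\nabla^k\to\nabla^g$ in $C^0$ as $k\to\infty$. Let $H\subseteq \mathrm{SO}(l)$ be a closed subset. Assume that for every $k\in\mathbb{N}$ there exists a positively oriented $g_k$-orthonormal basis of $E_x$ such that, with respect to this basis, $\mathrm{Hol}_x(\nabla^k)\subseteq H$. Then there exists a positively oriented $g$-orthonormal basis of $E_x$ such that, with respect to this basis, $\mathrm{Hol}_x(\nabla^g)\subseteq H$.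
   Context: $\mathrm{S}^2E^*$ is the symmetric tensor product of $E^*$ with itself; a bundle metric is a section of it that is positive definite on each fibre. A $C^0$-connection on $E$ is a connection whose coefficients in local trivializations are continuous. A connection $\nabla$ is compatible with a bundle metric $h$ if $X(h(v,w))=h(\nabla_Xv,w)+h(v,\nabla_Xw)$ for all $X\in TM$ and $v,w\in C^1(M,E)$. Convergence of connections: the difference of two $C^0$-connections is a continuous section of $T^*M\otimes E\otimes E^*$. The space of such sections carries the compact-open $C^0$-topology (uniform convergence on compact sets, measured in charts and trivializations), and $\nabla^k\to\nabla$ in $C^0$ means $\nabla^k-\nabla\to 0$ in this topology. Holonomy: for a piecewise $C^1$ loop $c:[0,1]\to M$ based at $x$ and a connection $\nabla$ on $E$, the parallel transport $P_c^\nabla:E_x\to E_x$ sends $e$ to $s(1)$, where $s$ is the unique section of $E$ along $c$ with $s(0)=e$ and $\nabla_{\dot c(t)}s(t)=0$. The holonomy group is $\mathrm{Hol}_x(\nabla)=\{P_c^\nabla : c \text{ a piecewise } C^1 \text{ loop based at } x\}\subseteq \mathrm{GL}(E_x)$. A basis of $E_x$ identifies $E_x$ with $\mathbb{R}^l$ and $\mathrm{GL}(E_x)$ with $\mathrm{GL}(l)$ (endomorphisms are replaced by their matrices); ''$\mathrm{Hol}_x(\nabla)\subseteq H$ with respect to this basis'' is meant under this identification. *)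

(* Defs.v *)
From HB Require Import structures.
From mathcomp Require Import all_boot all_order all_algebra.
From mathcomp Require Import all_classical all_reals all_analysis.

Set Implicit Arguments.
Unset Strict Implicit.
Unset Printing Implicit Defensive.

Import Order.TTheory GRing.Theory Num.Theory.
Import numFieldNormedType.Exports.

Local Open Scope classical_set_scope.
Local Open Scope ring_scope.

(* On an open set D this is the usual notion: in finite dimension, continuity
   of x |-> 'd f x v for every v is continuity of x |-> 'd f x. *)
Definition C1_on (R : realType) (V W : normedModType R) (D : set V)
    (f : V -> W) : Prop :=
  (forall x, D x -> differentiable f x) /\
  (forall v x, D x -> {for x, continuous (fun y => 'd f y v)}).

Definition C2_on (R : realType) (V W : normedModType R) (D : set V)
    (f : V -> W) : Prop :=
  (forall x, D x -> differentiable f x) /\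
  (forall v, C1_on D (fun x => 'd f x v : W)).

(* For D a nondegenerate closed interval this is the ordinary derivative at
   interior points and the one-sided derivative at the end points. *)
Definition has_deriv_within (R : realType) (W : normedModType R) (D : set R)
    (f : R -> W) (t : R) (v : W) : Prop :=
  (fun s => (s - t)^-1 *: (f s - f t)) @ within (D `\ t) (nbhs t) --> v.

(* Charts are total functions; only their values on chart_dom (and those of
   chart_inv on the open image of chart_dom) are meaningful.  The atlas need
   not be maximal. *)
Record C2_atlas (R : realType) (M : topologicalType) (m : nat) := C2Atlas {
  chart_idx : Type;
  chart_dom : chart_idx -> set M;
  chart : chart_idx -> M -> 'rV[R]_m;
  chart_inv : chart_idx -> 'rV[R]_m -> M;
  chart_dom_open : forall i, open (chart_dom i);
  chart_cover : forall y, exists i, chart_dom i y;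
  chart_img_open : forall i, open (chart i @` chart_dom i);
  chartK : forall i, {in chart_dom i, cancel (chart i) (chart_inv i)};
  chart_continuous : forall i, {within chart_dom i, continuous (chart i)};
  chart_inv_continuous : forall i,
    {within chart i @` chart_dom i, continuous (chart_inv i)};
  chart_compat : forall i j,
    C2_on (chart i @` (chart_dom i `&` chart_dom j))
          (chart j \o chart_inv i)
}.

Section Manifold.
Variables (R : realType) (M : topologicalType) (m : nat) (A : C2_atlas R M m).

Definition C1_fun_on (W : set M) (f : M -> R) : Prop :=
  forall i : chart_idx A, C1_on (chart i @` (W `&` chart_dom i))
                  (f \o chart_inv i : 'rV[R]_m -> R^o).

(* A tangent vector at y is the family of its coordinates in all the charts
   around y (and 0 for the other charts); linear operations are those of the
   function space chart_idx A -> 'rV_m. *)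
Definition tangent (y : M) : set (chart_idx A -> 'rV[R]_m) :=
  [set X | (forall i j : chart_idx A, chart_dom i y -> chart_dom j y ->
              X j = 'd (chart j \o chart_inv i) (chart i y) (X i)) /\
           (forall i : chart_idx A, ~ chart_dom i y -> X i = 0)].

(* The coordinate vector field d/dx^a of the chart i, at a point y of its
   domain. *)
Definition coord_vec (i : chart_idx A) (a : 'I_m) (y : M) :
    chart_idx A -> 'rV[R]_m :=
  fun k => if `[< chart_dom k y >]
           then 'd (chart k \o chart_inv i) (chart i y) (delta_mx 0 a)
           else 0.

(* X(f), computed in the chart i around y. *)
Definition tderiv (i : chart_idx A) (f : M -> R) (y : M)
    (X : chart_idx A -> 'rV[R]_m) : R :=
  'd (f \o chart_inv i : 'rV[R]_m -> R^o) (chart i y) (X i).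

Definition velocity (D : set R) (c : R -> M) (t : R)
    (X : chart_idx A -> 'rV[R]_m) : Prop :=
  tangent (c t) X /\
  forall i : chart_idx A, chart_dom i (c t) ->
    has_deriv_within D (chart i \o c) t (X i).

Definition C1_curve (a b : R) (c : R -> M) : Prop :=
  {within `[a, b], continuous c} /\
  exists cdot : R -> chart_idx A -> 'rV[R]_m,
    (forall t, t \in `[a, b] -> velocity `[a, b] c t (cdot t)) /\
    (forall i, {within [set` `[a, b]] `&` c @^-1` chart_dom i,
                 continuous (fun t => cdot t i)}).

Definition subdivision (n : nat) (t : nat -> R) : Prop :=
  [/\ t 0%N = 0, t n = 1 & forall k, (k < n)%N -> t k < t k.+1].

Definition piecewise_C1 (c : R -> M) : Prop :=
  exists n t, subdivision n t /\
    forall k, (k < n)%N -> C1_curve (t k) (t k.+1) c.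

End Manifold.

(* A C^1 vector bundle of rank l, presented by its fibres and a family of
   fibrewise linear local trivializations with C^1 transition functions; these
   determine the topology and the C^1 structure of the total space. *)
Record C1_bundle (R : realType) (M : topologicalType) (m : nat)
    (A : C2_atlas R M m) (l : nat) := C1Bundle {
  fibre :> M -> vectType R;
  triv_idx : Type;
  triv_dom : triv_idx -> set M;
  triv : triv_idx -> forall y, {linear fibre y -> 'rV[R]_l};
  triv_inv : triv_idx -> forall y, {linear 'rV[R]_l -> fibre y};
  triv_dom_open : forall j, open (triv_dom j);
  triv_cover : forall y, exists j, triv_dom j y;
  trivK : forall j y, triv_dom j y -> cancel (triv j y) (triv_inv j y);
  triv_invK : forall j y, triv_dom j y -> cancel (triv_inv j y) (triv j y);
  triv_compat : forall (i : chart_idx A) j j' v,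
    C1_on (chart i @` (chart_dom i `&` triv_dom j `&` triv_dom j'))
          (fun z => triv j' (chart_inv i z) (triv_inv j (chart_inv i z) v)
                    : 'rV[R]_l)
}.

Section Bundle.
Variables (R : realType) (M : topologicalType) (m : nat) (A : C2_atlas R M m).
Variables (l : nat) (E : C1_bundle A l).

Definition frame (j : triv_idx E) (y : M) : l.-tuple (E y) :=
  [tuple triv_inv j y (delta_mx 0 a) | a < l].

(* An orientation of each fibre, i.e. a choice of one of the classes of bases
   modulo base changes of positive determinant, which is locally constant in
   local trivializations. *)
Record orientation := Orientation {
  positively_oriented : forall y, l.-tuple (E y) -> Prop;
  positively_oriented_basis : forall y (b : l.-tuple (E y)),
    positively_oriented b -> basis_of fullv b;
  positively_oriented_ex : forall y,
    exists b : l.-tuple (E y), positively_oriented b;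
  positively_oriented_det : forall y (b b' : l.-tuple (E y)),
    positively_oriented b -> basis_of fullv b' ->
    (positively_oriented b' <->
       0 < \det (\matrix_(p < l, q < l) coord b p (tnth b' q)));
  positively_oriented_locally_constant : forall j y, triv_dom j y ->
    \forall z \near y,
      positively_oriented (frame j z) <-> positively_oriented (frame j y)
}.

Definition C1_section_on (W : set M) (s : forall y, E y) : Prop :=
  forall (i : chart_idx A) (j : triv_idx E),
    C1_on (chart i @` (W `&` chart_dom i `&` triv_dom j))
          (fun z => triv j (chart_inv i z) (s (chart_inv i z)) : 'rV[R]_l).

Definition C1_section_near (y : M) (s : forall z, E z) : Prop :=
  exists2 W : set M, open_nbhs y W & C1_section_on W s.

(* C^1 sections of S^2 E^* that are positive definite on each fibre. *)
Record bundle_metric := BundleMetric {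
  metric :> forall y, E y -> E y -> R;
  metricC : forall y (v w : E y), metric v w = metric w v;
  metric_linear : forall y (a : R) (u v w : E y),
    metric (a *: u + v) w = a * metric u w + metric v w;
  metric_gt0 : forall y (v : E y), v != 0 -> 0 < metric v v;
  metric_C1 : forall (i : chart_idx A) j (v w : 'rV[R]_l),
    C1_on (chart i @` (chart_dom i `&` triv_dom j))
          (fun z => metric (triv_inv j (chart_inv i z) v)
                           (triv_inv j (chart_inv i z) w) : R^o)
}.

Definition gram (h : bundle_metric) (y : M) (b : l.-tuple (E y)) : 'M[R]_l :=
  \matrix_(p, q) h y (tnth b p) (tnth b q).

Definition metric_orthonormal (h : bundle_metric) (y : M)
    (b : l.-tuple (E y)) : Prop :=
  basis_of fullv b /\
  forall p q, h y (tnth b p) (tnth b q) = (p == q)%:R.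

(* The q-th local frame field of the trivialization j is
   z |-> triv_inv j z (delta_mx 0 q); this is the coefficient Gamma_{a q}^p of
   nabla in the chart i and the trivialization j. *)
Definition conn_coef
    (nabla : forall y, (chart_idx A -> 'rV[R]_m) -> (forall z, E z) -> E y)
    (i : chart_idx A) (j : triv_idx E) (a : 'I_m) (p q : 'I_l) (y : M) : R :=
  (triv j y (nabla y (coord_vec i a y)
                   (fun z => triv_inv j z (delta_mx 0 q))) : 'rV[R]_l) 0 p.

(* A connection is a covariant derivative acting on local C^1 sections.  A
   section on a neighbourhood of y is represented by a function on M, whose
   values away from y are irrelevant: taking for f in nabla_leibniz an
   indicator function constant near y shows that nabla y X s depends only on
   the germ of s at y.  Values at arguments that are not tangent vectors or
   not C^1 near y are unspecified and never used. *)
Record C0_connection := C0Connection {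
  nabla :> forall y, (chart_idx A -> 'rV[R]_m) -> (forall z, E z) -> E y;
  nabla_linear : forall y (a : R) X Y s,
    tangent y X -> tangent y Y -> C1_section_near y s ->
    nabla y (a *: X + Y) s = a *: nabla y X s + nabla y Y s;
  nabla_additive : forall y X s s',
    tangent y X -> C1_section_near y s -> C1_section_near y s' ->
    nabla y X (fun z => s z + s' z) = nabla y X s + nabla y X s';
  nabla_leibniz : forall y X (f : M -> R) s i,
    tangent y X -> (exists2 W, open_nbhs y W & C1_fun_on A W f) ->
    C1_section_near y s -> chart_dom i y ->
    nabla y X (fun z => f z *: s z) =
      tderiv i f y X *: s y + f y *: nabla y X s;
  nabla_C0 : forall i j a p q,
    {within chart_dom i `&` triv_dom j,
      continuous (conn_coef nabla i j a p q)}
}.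

Definition compatible (D : C0_connection) (h : bundle_metric) : Prop :=
  forall y X v w i,
    tangent y X -> C1_section_on setT v -> C1_section_on setT w ->
    chart_dom i y ->
    tderiv i (fun z => h z (v z) (w z)) y X =
      h y (D y X v) (w y) + h y (v y) (D y X w).

(* Uniform convergence on compact sets of the components of the sections
   D_ k - D of T^*M (x) E (x) E^*, in charts and trivializations. *)
Definition C0_converges (D_ : nat -> C0_connection) (D : C0_connection) :
    Prop :=
  forall (i : chart_idx A) (j : triv_idx E) (K : set M),
  compact K -> K `<=` chart_dom i `&` triv_dom j ->
  forall a p q,
    {uniform K, (fun k y => conn_coef (D_ k) i j a p q y
                            - conn_coef D i j a p q y) @ \oo --> cst (0 : R)}.

(* w is the covariant derivative at time t of the section s along c, where X
   is the velocity of c at t: in a trivialization, with u the coordinates of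
   s, the coordinates of w are u'(t) + Gamma(X) u(t). *)
Definition cov_deriv (D : C0_connection) (I : set R) (c : R -> M)
    (s : forall t, E (c t)) (t : R) (X : chart_idx A -> 'rV[R]_m)
    (w : E (c t)) : Prop :=
  forall j, triv_dom j (c t) ->
    has_deriv_within I (fun r => triv j (c r) (s r) : 'rV[R]_l) t
      (triv j (c t) w
       - triv j (c t) (D (c t) X
           (fun y => triv_inv j y (triv j (c t) (s t))))).

Definition parallel (D : C0_connection) (c : R -> M) (s : forall t, E (c t)) :
    Prop :=
  exists n t, subdivision n t /\
    forall k, (k < n)%N ->
      C1_curve A (t k) (t k.+1) c /\
      forall r X, r \in `[t k, t k.+1] -> velocity `[t k, t k.+1] c r X ->
        cov_deriv D `[t k, t k.+1] s X (0 : E (c r)).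

(* P is the parallel transport around the loop c at x.  The end point
   conditions are stated in the total space, because c 0 = c 1 = x holds only
   propositionally. *)
Definition is_transport (D : C0_connection) (x : M) (c : R -> M)
    (P : E x -> E x) : Prop :=
  forall e : E x, exists s : forall t, E (c t),
    [/\ parallel D s,
        Tagged (fibre E) (s 0) = Tagged (fibre E) e &
        Tagged (fibre E) (s 1) = Tagged (fibre E) (P e)].

Definition Hol (D : C0_connection) (x : M) : set (E x -> E x) :=
  [set P | exists c : R -> M,
     [/\ piecewise_C1 A c, c 0 = x, c 1 = x & is_transport D c P]].

(* The columns are the coordinates of the images of the basis vectors. *)
Definition mx_in_basis (y : M) (b : l.-tuple (E y)) (P : E y -> E y) :
    'M[R]_l :=
  \matrix_(p, q) coord b p (P (tnth b q)).

End Bundle.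

Arguments Hol {R M m A l E} D x _.

Definition SO (R : realType) (l : nat) : set 'M[R]_l :=
  [set B | B^T *m B = 1%:M /\ \det B = 1].
Arguments SO : clear implicits.

(* Main.v *)
Require Import Defs.
From HB Require Import structures.
From mathcomp Require Import all_boot all_order all_algebra.
From mathcomp Require Import all_classical all_reals all_analysis.
From mathcomp Require Import ring lra zify.
Import Order.TTheory GRing.Theory Num.Theory.
Import numFieldNormedType.Exports.
Local Open Scope classical_set_scope.
Local Open Scope ring_scope.

(** Along a fixed curve, parallel transport solves a linear ODE whose
    coefficients are the connection coefficients contracted with the velocity.
    C^0 convergence of the connections gives uniform convergence of these
    coefficients on the compact image of the curve, so by Gronwall's lemma the
    transports along each loop converge.  The orthonormal bases given for the
    g_k have coordinate matrices B_k with B_k B_k^T = G_k^-1, where G_k is the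
    Gram matrix of g_k; hence they are bounded and converge along an
    ultrafilter finer than the Frechet filter, to a positively oriented
    g-orthonormal basis.  In these bases the holonomy matrices of the D_k
    converge, along the same ultrafilter, to that of D, and H is closed.  The
    ultrafilter provides one limit basis for all loops at once and makes a
    choice of subsequences unnecessary. *)

(** * Linear differential equations *)

(** An element [P] of the holonomy of [D] is known only through the existence of parallel sections
    with prescribed end values. For the same loop, an element of the holonomy of every [D_ k] has to
    be produced, so the argument needs existence for linear equations with merely continuous
    coefficients as well as the Gronwall estimate. That estimate compares any solution for [D_ k]
    with the section that comes with [P]. The map [P_ k] is then assembled by choice: on the vectors
    of the k-th basis it takes the end values of sections already known to converge, on other
    vectors the end value of some parallel section. Orthonormality serves twice. It bounds the base
    changes, and it turns the (p, q) entry of a holonomy matrix into the metric value of the p-th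
    basis vector and the image of the q-th. Expanded in one fixed basis, this is a polynomial in
    convergent quantities, so no inverse of a varying base change has to be followed to the
    limit. *)

Lemma cvg_sumr (R : realType) (I : finType) (T : Type) (F : set_system T)
    (f : I -> T -> R) (g : I -> R) {FF : Filter F} :
  (forall i, f i x @[x --> F] --> g i) -> \sum_i f i x @[x --> F] --> \sum_i g i.
Proof.
by move=> h; apply: cvg_big => [|i _]; [exact: add_continuous|exact: h].
Qed.

Section real_analysis.
Variable R : realType.
Implicit Types (a b t : R).

Lemma antiderivative (f : R -> R) a b : continuous f ->
  exists2 F : R -> R, F a = 0 & forall t, t \in `[a, b] -> is_derive t 1 F (f t).
Proof.
move=> cf.
(* The integral starts at [a - 1] and the fundamental theorem is applied on [[a - 1, b + 1]], so
   that [a] and [b] are interior points and the derivative is two-sided there too. *)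
pose F x := (\int[@lebesgue_measure R]_(t in `[(a - 1)%R, x]) (f t))%R.
exists (fun x => F x - F a); first by rewrite subrr.
move=> t; rewrite in_itv/= => /andP[at_ tb].
have tb1 : t < b + 1 by lra.
have at1 : a - 1 < t by lra.
have intf : (@lebesgue_measure R).-integrable `[a - 1, b + 1] (EFin \o f).
  apply: continuous_compact_integrable; first exact: segment_compact.
  exact: continuous_subspaceT.
have [dF eF] := continuous_FTC1_closed tb1 intf at1 (cf t).
have dF' : is_derive t 1 F (f t).
  by rewrite -eF derive1E; exact: derivableP.
have -> : (fun x => F x - F a) = F - cst (F a) by apply/funext.
by apply: is_derive_eq; rewrite subr0.
Qed.

(** Mean value inequality: for [e = 1] and for [e = -1] the function [g - e *: f] has a nonnegative
    derivative, and the two signs together give the absolute value. *)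
Lemma ler_dist_derive (f g df dg : R -> R) a b : a <= b ->
  (forall t, t \in `[a, b] -> is_derive t 1 f (df t)) ->
  (forall t, t \in `[a, b] -> is_derive t 1 g (dg t)) ->
  (forall t, t \in `[a, b] -> `|df t| <= dg t) ->
  `|f b - f a| <= g b - g a.
Proof.
move=> ab hf hg hfg.
have sub t : t \in `]a, b[ -> t \in `[a, b] by apply: subset_itv_oo_cc.
have C (h dh : R -> R) : (forall t, t \in `[a, b] -> is_derive t 1 h (dh t)) ->
    {within `[a, b], continuous h}.
  move=> hh; apply: derivable_within_continuous => t tab.
  by have [] := hh _ tab.
have main (e : R) : `|e| = 1 -> e * (f b - f a) <= g b - g a.
  move=> e1; pose h := g - e *: (f : R -> R^o).
  have dh t : t \in `[a, b] -> is_derive t 1 (h : R -> R) (dg t - e * df t).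
    move=> tab; have := hf _ tab; have := hg _ tab => ? ?.
    by rewrite /h; apply: is_derive_eq.
  have [c cab E] := @MVT_segment _ h _ a b ab (fun t tab => dh t (sub t tab)) (C _ _ dh).
  have : 0 <= (dg c - e * df c) * (b - a).
    rewrite mulr_ge0 ?subr_ge0 //; apply: le_trans (hfg _ cab).
    by apply: le_trans (ler_norm _) _; rewrite normrM e1 mul1r.
  rewrite -E /h !fctE /GRing.scale/=; lra.
rewrite ler_norml; apply/andP; split; last first.
  by have := main 1 (normr1 _); rewrite mul1r.
by have := main (-1) (normrN1 _); rewrite mulN1r; lra.
Qed.

(** The radius [2 * C / 2 ^+ n] is the sum of all later step bounds, so the intervals of this radius
    around [x n] are nested. The limit is the supremum of their left ends. *)
Lemma geometric_limit (x : nat -> R) (C : R) :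
  (forall n, `|x n.+1 - x n| <= C / 2 ^+ n) ->
  exists l, forall n, `|l - x n| <= 2 * C / 2 ^+ n.
Proof.
move=> hx.
have pow n : 2 * C / 2 ^+ n.+1 = C / 2 ^+ n.
  by rewrite exprS invfM mulrA; field.
have C0 : 0 <= C by have := hx 0%N; rewrite expr0 divr1; apply: le_trans.
have P n : 0 <= 2 * C / 2 ^+ n by rewrite !mulr_ge0// invr_ge0 exprn_ge0.
pose z n := x n - 2 * C / 2 ^+ n; pose y n := x n + 2 * C / 2 ^+ n.
have E n : 2 * C / 2 ^+ n = 2 * (C / 2 ^+ n) by rewrite mulrA.
have zS n : z n <= z n.+1.
  by rewrite /z pow E; have := hx n; rewrite ler_norml => /andP[]; lra.
have yS n : y n.+1 <= y n.
  by rewrite /y pow E; have := hx n; rewrite ler_norml => /andP[]; lra.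
have zm m n : (m <= n)%N -> z m <= z n.
  by move=> /subnK <-; elim: (n - m)%N => //= k IH; apply: le_trans IH (zS _).
have ym m n : (m <= n)%N -> y n <= y m.
  by move=> /subnK <-; elim: (n - m)%N => //= k IH; apply: le_trans (yS _) IH.
have zy m n : z m <= y n.
  apply: le_trans (zm _ _ (leq_maxl m n)) _.
  apply: le_trans (ym _ _ (leq_maxr m n)).
  by have := P (maxn m n); rewrite /z /y; lra.
have ub n : ubound (range z) (y n) by move=> _ [m _ <-].
have hs : has_sup (range z) by split; [exists (z 0%N), 0%N|exists (y 0%N)].
exists (sup (range z)) => n.
have l1 : z n <= sup (range z) by apply: ub_le_sup; [case: hs|exists n].
have l2 : sup (range z) <= y n by apply: ge_sup => //; case: hs.
by rewrite ler_norml; move: l1 l2; rewrite /z /y => *; apply/andP; split; lra.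
Qed.

Lemma small_geometric (C e : R) : 0 < e -> exists n, C / 2 ^+ n < e.
Proof.
move=> e0; exists (Num.truncn (`|C| / e)).
rewrite ltr_pdivrMr ?exprn_gt0// mulrC -ltr_pdivrMr//.
apply: le_lt_trans (_ : `|C| / e < _); first by rewrite ler_pM2r ?invr_gt0// ler_norm.
apply: lt_le_trans (truncnS_gt _) _.
by rewrite -natrX ler_nat ltn_expl.
Qed.

Lemma eq_of_geometric_bound (x y : R) (C : R) :
  (forall n, `|x - y| <= C / 2 ^+ n) -> x = y.
Proof.
move=> h; apply/eqP; rewrite -subr_eq0 -normr_eq0 eq_le normr_ge0 andbT.
rewrite leNgt; apply/negP => /(small_geometric C)[n].
by rewrite ltNge h.
Qed.

Lemma continuous_bounded_itv (f : R -> R) a b : a <= b ->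
  {within `[a, b], continuous f} ->
  exists2 K : R, 0 <= K & forall t, t \in `[a, b] -> `|f t| <= K.
Proof.
move=> ab cf.
have cn : {within `[a, b], continuous (fun t => `|f t|)}.
  by move=> t; apply: cvg_norm; exact: cf.
have [c _ hc] := EVT_max ab cn.
by exists `|f c|.
Qed.

Lemma continuous_bounded_itv_family (I : finType) (f : I -> R -> R) a b : a <= b ->
  (forall i, {within `[a, b], continuous (f i)}) ->
  exists2 K : R, 0 <= K & forall i t, t \in `[a, b] -> `|f i t| <= K.
Proof.
move=> ab cf.
have /choice[K hK] : forall i, exists K : R, 0 <= K /\
    forall t, t \in `[a, b] -> `|f i t| <= K.
  by move=> i; have [K K0 hK] := continuous_bounded_itv (f i) a b ab (cf i); exists K.
exists (\sum_i K i); first by apply: sumr_ge0 => i _; case: (hK i).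
move=> i t tab; rewrite (bigD1 i)//=; apply: le_trans ((hK i).2 t tab) _.
by rewrite lerDl sumr_ge0// => j _; case: (hK j).
Qed.

(** The retraction of the line onto [[a, b]] when [a <= b]. Composing with it extends a function
    continuous within [[a, b]] to a continuous function on the whole line, as [antiderivative] and
    [linear_ode_exists] require. *)
Definition clamp a b t := Num.max a (Num.min t b).

Lemma clamp_id a b t : t \in `[a, b] -> clamp a b t = t.
Proof.
by rewrite in_itv/= /clamp => /andP[at_ tb]; rewrite (min_idPl tb) (max_idPr at_).
Qed.

Lemma clamp_itv a b t : a <= b -> clamp a b t \in `[a, b].
Proof.
by move=> ab; rewrite in_itv/= /clamp le_max lexx/= ge_max ab ge_min lexx orbT.
Qed.

Lemma clamp_continuous a b : continuous (clamp a b).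
Proof.
move=> t.
have cmin : {for t, continuous ((id : R -> R^o) \min (cst b : R -> R^o))}.
  by apply: continuous_min; [exact: cvg_id|exact: cst_continuous].
by apply: (@continuous_max _ _ (cst a : R -> R^o) _ t _ cmin); exact: cst_continuous.
Qed.

Lemma continuous_clamp (T : topologicalType) (f : R -> T) a b : a <= b ->
  {within `[a, b], continuous f} -> continuous (f \o clamp a b).
Proof.
move=> ab cf t.
have /subspace_continuousP/(_ (clamp a b t) (clamp_itv _ _ t ab)) := cf.
apply: cvg_trans => B /= hB.
have /(_ _ hB) hB0 := @clamp_continuous a b t.
have : \forall s \near t, B (f (clamp a b s)); last by [].
have : \forall s \near t, `[a, b]%classic (clamp a b s) -> B (f (clamp a b s)) := hB0.
by apply: filterS => s; apply; exact: clamp_itv.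
Qed.

Section linear_ode.
Variable l : nat.
Implicit Types (A : 'I_l -> 'I_l -> R -> R) (w u : 'I_l -> R -> R).

Lemma ler_norm_sum_mul (A : 'I_l -> R) (w : 'I_l -> R) (K W : R) :
  (forall q, `|A q| <= K) -> (forall q, `|w q| <= W) ->
  `|\sum_q A q * w q| <= l%:R * (K * W).
Proof.
move=> hA hw; apply: le_trans (ler_norm_sum _ _ _) _.
have -> : l%:R * (K * W) = \sum_(q < l) K * W by rewrite sumr_const card_ord mulr_natl.
by apply: ler_sum => q _; rewrite normrM ler_pM.
Qed.

(* Picard iteration, with the exponential weight of Bielecki so that it
   contracts on the whole interval. *)
Lemma linear_ode_exists A (v : 'I_l -> R) a b : a <= b ->
  (forall p q, continuous (A p q)) ->
  exists u, (forall p, u p a = v p) /\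
    forall p t, t \in `[a, b] -> is_derive t 1 (u p) (\sum_q A p q t * u q t).
Proof.
move=> ab cA.
have aab : a \in `[a, b] by rewrite in_itv/= lexx.
pose ctn w := forall p, continuous (w p).
(* [T] is the Picard operator, which sends [w] to [v] plus the integral of [A w] from [a]. It is
   total, with the arbitrary value [w] at a discontinuous [w]. *)
have [T hT] : {T : ('I_l -> R -> R) -> ('I_l -> R -> R) &
    forall w, ctn w -> forall p, T w p a = v p /\
    forall t, t \in `[a, b] -> is_derive t 1 (T w p) (\sum_q A p q t * w q t)}.
  apply: (@choice _ _ (fun w w' => ctn w -> forall p, w' p a = v p /\
    forall t, t \in `[a, b] -> is_derive t 1 (w' p) (\sum_q A p q t * w q t))) => w.
  have [cw|] := pselect (ctn w); last by exists w.
  have [F hF] : {F : 'I_l -> R -> R & forall p, F p a = 0 /\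
      forall t, t \in `[a, b] -> is_derive t 1 (F p) (\sum_q A p q t * w q t)}.
    apply: (@choice _ _ (fun p f => f a = 0 /\
      forall t, t \in `[a, b] -> is_derive t 1 f (\sum_q A p q t * w q t))) => p.
    have cs : continuous (fun t => \sum_q A p q t * w q t).
      move=> t; apply: (@cvg_sumr _ _ _ _ (fun q t => A p q t * w q t)) => q.
      by apply: cvgM; [exact: cA|exact: cw].
    by have [F F0 dF] := antiderivative _ a b cs; exists F.
  exists (fun p t => v p + F p t) => _ p; have [F0 dF] := hF p.
  split=> [|t tab]; first by rewrite F0 addr0.
  have dFt := dF t tab.
  have -> : (fun t => v p + F p t) = cst (v p) + F p by apply/funext.
  by apply: is_derive_eq; rewrite add0r.
have cT w p : ctn w -> {within `[a, b], continuous (T w p)}.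
  move=> cw; apply: derivable_within_continuous => t tab.
  by have [_ /(_ t tab)[]] := hT w cw p.
(* Each iterate is clamped because [T] controls its output on [[a, b]] only, while the next
   application needs continuity on the whole line. *)
pose w_ := fix w n := if n is n'.+1 then fun p t => T (w n') p (clamp a b t)
                      else fun p t => v p.
have cw n : ctn (w_ n).
  elim: n => [|n IH] p /=; first by move=> t; exact: cst_continuous.
  by apply: (@continuous_clamp R (T (w_ n) p)) => //; exact: cT.
have wE n p t : t \in `[a, b] -> w_ n.+1 p t = T (w_ n) p t.
  by move=> tab /=; rewrite clamp_id.
have wcl n p t : w_ n p (clamp a b t) = w_ n p t.
  by case: n => //= n; rewrite (clamp_id _ _ (clamp a b t))//; exact: clamp_itv.
have [K K0 hK'] : exists2 K : R, 0 <= K &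
    forall (pq : 'I_l * 'I_l) t, t \in `[a, b] -> `|A pq.1 pq.2 t| <= K.
  apply: continuous_bounded_itv_family => // pq.
  by apply: continuous_subspaceT => t; exact: cA.
have hK p q t := hK' (p, q) t.
have [C0 C00 hC0] : exists2 C : R, 0 <= C &
    forall p t, t \in `[a, b] -> `|w_ 1%N p t - w_ 0%N p t| <= C.
  apply: (continuous_bounded_itv_family _ (fun p t => w_ 1%N p t - w_ 0%N p t)) => // p.
  by apply: continuous_subspaceT => t; apply: cvgB; exact: cw.
(* The summand 1 keeps [L] positive also when [l] or [K] vanishes. *)
pose L := l%:R * K + 1.
have L0 : 0 < L by rewrite ltr_wpDl// mulr_ge0.
(* [T w - T w'] vanishes at [a] and has derivative [A (w - w')], so any [f] whose derivative
   dominates [l%:R * (K * W)] bounds it. The choice of [f] is left open: an exponential for the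
   iterates, a linear function for the limit. *)
have diffT w w' (W f df : R -> R) : ctn w -> ctn w' ->
    (forall t, t \in `[a, b] -> is_derive t 1 f (df t)) ->
    (forall q t, t \in `[a, b] -> `|w q t - w' q t| <= W t) ->
    (forall t, t \in `[a, b] -> l%:R * (K * W t) <= df t) ->
    forall p t, t \in `[a, b] -> `|T w p t - T w' p t| <= f t - f a.
  move=> cw1 cw2 hf hW hWd p t tab.
  have [at_ tb] : a <= t /\ t <= b by move: tab; rewrite in_itv/= => /andP[].
  have [Ta dT] := hT w cw1 p; have [Ta' dT'] := hT w' cw2 p.
  have sub s : s \in `[a, t] -> s \in `[a, b].
    by rewrite !in_itv/= => /andP[-> /le_trans->].
  have -> : T w p t - T w' p t = (T w p t - T w' p t) - (T w p a - T w' p a).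
    by rewrite Ta Ta' subrr subr0.
  pose g s := T w p s - T w' p s.
  pose dg s := \sum_q A p q s * w q s - \sum_q A p q s * w' q s.
  rewrite -[T w p t - T w' p t]/(g t) -[T w p a - T w' p a]/(g a).
  refine (@ler_dist_derive g f dg df a t at_ _ _ _).
  - move=> s /sub sab; have := dT s sab; have := dT' s sab => ? ?.
    have -> : g = T w p - T w' p by apply/funext.
    exact: is_deriveB.
  - by move=> s /sub; exact: hf.
  - move=> s /sub sab; rewrite /dg -sumrB.
    under eq_bigr do rewrite -mulrBr.
    apply: le_trans (hWd _ sab).
    by apply: ler_norm_sum_mul => q; [exact: hK|exact: hW].
(* Integrating the weight [expR (2 * L * (t - a))] divides it by [2 * L], while applying [A] costs
   at most [l%:R * K <= L]. Each iteration thus gains the factor 1/2. *)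
have hn n p t : t \in `[a, b] ->
    `|w_ n.+1 p t - w_ n p t| <= C0 / 2 ^+ n * expR (2 * L * (t - a)).
  elim: n p t => [|n IH] p t tab.
    rewrite expr0 divr1; apply: le_trans (hC0 p t tab) _.
    rewrite ler_peMr//; apply: le_trans (expR_ge1Dx _); rewrite lerDl.
    by rewrite !mulr_ge0// ?(ltW L0)// subr_ge0; move: tab; rewrite in_itv => /andP[].
  rewrite !wE//.
  pose f t := C0 / 2 ^+ n.+1 * expR (2 * L * (t - a)).
  pose W t := C0 / 2 ^+ n * expR (2 * L * (t - a)).
  have fa : 0 <= f a by rewrite /f !mulr_ge0// ?expR_ge0// invr_ge0 exprn_ge0.
  apply: le_trans (_ : f t - f a <= _); last by rewrite /f lerBlDr lerDl.
  apply: (diffT _ _ W f (fun t => 2 * L * f t) (cw n.+1) (cw n)) => //.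
  - move=> s _; rewrite /f.
    by apply: is_derive_eq; rewrite /GRing.scale/=; ring.
  - move=> s sab; have -> : 2 * L * f s = L * W s.
      by rewrite /f /W exprS; field; rewrite expf_neq0.
    rewrite mulrA ler_wpM2r//; last by rewrite /L lerDl.
    by rewrite /W !mulr_ge0// ?expR_ge0// invr_ge0 exprn_ge0.
pose C := C0 * expR (2 * L * (b - a)).
have C_ge0 : 0 <= C by rewrite mulr_ge0// expR_ge0.
have hC n p t : `|w_ n.+1 p t - w_ n p t| <= C / 2 ^+ n.
  rewrite -wcl -[w_ n p t]wcl; have cab := clamp_itv _ _ t ab.
  apply: le_trans (hn n p _ cab) _; rewrite /C mulrAC ler_wpM2r ?invr_ge0 ?exprn_ge0//.
  rewrite ler_wpM2l// ler_expR ler_wpM2l ?(mulr_ge0 _ (ltW L0))// lerB//.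
  by move: cab; rewrite in_itv/= => /andP[].
have /choice[winf hwinf] : forall pt : 'I_l * R, exists x, forall n,
    `|x - w_ n pt.1 pt.2| <= 2 * C / 2 ^+ n.
  by move=> [p t]; apply: geometric_limit => n; exact: hC.
pose w p t := winf (p, t).
have hw p t n : `|w p t - w_ n p t| <= 2 * C / 2 ^+ n by exact: hwinf (p, t) n.
have cwi : ctn w.
  move=> p t; apply/cvgrPdist_lt => e e0.
  have [n nC] := @small_geometric (2 * C) (e / 3) (divr_gt0 e0 (ltr0Sn _ 2)).
  have /cvgrPdist_lt/(_ (e / 3) (divr_gt0 e0 (ltr0Sn _ 2))) := cw n p t.
  apply: filterS => s hs.
  have h1 := hw p t n; have h2 := hw p s n; rewrite distrC in h2.
  have -> : w p t - w p s = (w p t - w_ n p t) + (w_ n p t - w_ n p s)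
     + (w_ n p s - w p s) by ring.
  apply: le_lt_trans (ler_normD _ _) _.
  have := ler_normD (w p t - w_ n p t) (w_ n p t - w_ n p s); lra.
(* Both sides are compared with [w_ n.+1 = T (w_ n)]: the left one differs from it by at most
   [D / 2 ^+ n] because [T] is Lipschitz, the right one by at most [2 * C / 2 ^+ n] by
   construction. *)
have wT p t : t \in `[a, b] -> T w p t = w p t.
  move=> tab; pose D := l%:R * (K * (2 * C)) * (b - a).
  apply: (@eq_of_geometric_bound _ _ (D + 2 * C)) => n.
  have [at_ tb] : a <= t /\ t <= b by move: tab; rewrite in_itv/= => /andP[].
  pose W (t : R) := 2 * C / 2 ^+ n.
  have W0 : 0 <= 2 * C / 2 ^+ n by rewrite !mulr_ge0// invr_ge0 exprn_ge0.
  have h1 : `|T w p t - T (w_ n) p t| <= D / 2 ^+ n.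
    pose f t := l%:R * (K * (2 * C / 2 ^+ n)) * t.
    apply: le_trans (_ : f t - f a <= _).
      apply: (diffT _ _ W f (fun t => l%:R * (K * (2 * C / 2 ^+ n)))) => //.
      by move=> s _; apply: is_derive_eq; rewrite /GRing.scale/= mulr1.
    rewrite /f -mulrBr.
    have -> : D / 2 ^+ n = l%:R * (K * (2 * C / 2 ^+ n)) * (b - a) by rewrite /D; ring.
    by rewrite ler_wpM2l ?lerB// !mulr_ge0// invr_ge0 exprn_ge0.
  have h2 := hw p t n.+1; rewrite wE// in h2.
  have h3 : 2 * C / 2 ^+ n.+1 <= 2 * C / 2 ^+ n.
    rewrite ler_wpM2l ?mulr_ge0// lef_pV2 ?posrE ?exprn_gt0//.
    by rewrite exprS ler_peMl ?exprn_ge0// ler1n.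
  have -> : T w p t - w p t = (T w p t - T (w_ n) p t) + (T (w_ n) p t - w p t) by ring.
  apply: le_trans (ler_normD _ _) _; rewrite mulrDl (distrC (T (w_ n) p t)); lra.
(* The solution is [T w] rather than [w]: they agree on [[a, b]], but at [a] and [b] the derivative
   claimed is two-sided, and this is known for [T w]. *)
exists (T w); split=> [p|p t tab]; first by have [] := hT w cwi p.
have [_ /(_ t tab)] := hT w cwi p.
by under eq_bigr do rewrite -wT//.
Qed.

(** The sum of squares [phi] is differentiable where the sum of absolute values need not be. By 2yz
    <= y^2 + z^2 its derivative is at most [C * (phi + e ^+ 2)], so [psi] does not increase. In [C],
    the term [2 * K * l%:R] comes from the double sum, 1 from the products of [d p] with the error
    [e], and [l%:R] from the [l] copies of [e ^+ 2]. *)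
Lemma gronwall_sqr (d d' : 'I_l -> R -> R) (K e : R) a b : a <= b -> 0 <= K ->
  (forall p, {within `[a, b], continuous (d p)}) ->
  (forall p t, t \in `]a, b[ -> is_derive t 1 (d p) (d' p t)) ->
  (forall p t, t \in `]a, b[ -> `|d' p t| <= K * (\sum_q `|d q t|) + e) ->
  \sum_p d p b ^+ 2 <=
    (\sum_p d p a ^+ 2 + e ^+ 2) * expR ((2 * K * l%:R + 1 + l%:R) * (b - a)).
Proof.
move=> ab K0 cd dd hd'.
pose C := 2 * K * l%:R + 1 + l%:R.
pose phi t := \sum_p d p t ^+ 2.
pose psi t := (phi t + e ^+ 2) * expR (- C * t).
have phi0 t : 0 <= phi t by apply: sumr_ge0 => p _; exact: sqr_ge0.
have dphi t : t \in `]a, b[ -> is_derive t 1 phi (\sum_p 2 * (d p t * d' p t)).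
  move=> tab.
  have -> : phi = \sum_p (d p) ^+ 2.
    by apply/funext => s; rewrite /phi fct_sumE.
  have H p := dd p t tab.
  apply: is_derive_eq; apply: eq_bigr => p _.
  by rewrite expr1 /GRing.scale/=; ring.
have dexp t : is_derive t 1 (fun t => expR (- C * t)) (- C * expR (- C * t)).
  by apply: is_derive_eq; rewrite /GRing.scale/=; ring.
have dpsi t : t \in `]a, b[ -> is_derive t 1 psi
    ((\sum_p 2 * (d p t * d' p t) - C * (phi t + e ^+ 2)) * expR (- C * t)).
  move=> tab; have ? := dphi t tab; have ? := dexp t.
  have -> : psi = (phi + cst (e ^+ 2)) * (fun t => expR (- C * t)) by apply/funext.
  by apply: is_derive_eq; rewrite !fctE /GRing.scale/=; ring.
have cpsi : {within `[a, b], continuous psi}.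
  move=> t; apply: cvgM; last first.
    apply: continuous_subspaceT => s.
    by apply: differentiable_continuous; apply/derivable1_diffP; case: (dexp s).
  apply: cvgD; last exact: cvg_cst.
  have cphi : {within `[a, b], continuous phi}.
    apply/subspace_continuousP => x xab.
    apply: (@cvg_sumr _ _ _ _ (fun p s => d p s ^+ 2)) => p.
    by apply: (@cvgM R); have /subspace_continuousP := cd p; exact.
  exact: cphi.
have : psi b <= psi a.
  have inn x : x \in `]a, b[ -> (psi^`())%classic x <= 0.
    move=> xab; rewrite derive1E (@derive_val _ _ _ _ _ _ _ (dpsi x xab)).
    rewrite mulr_le0_ge0 ?expR_ge0// subr_le0.
    have step p : 2 * (d p x * d' p x) <=
        K * \sum_q (d p x ^+ 2 + d q x ^+ 2) + (d p x ^+ 2 + e ^+ 2).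
      apply: le_trans (_ : 2 * (`|d p x| * (K * (\sum_q `|d q x|) + e)) <= _).
        rewrite ler_pM2l// (le_trans (ler_norm _))// normrM ler_wpM2l//.
        exact: hd'.
      rewrite [X in X <= _](_ : _ = K * (\sum_q 2 * (`|d p x| * `|d q x|)) +
          2 * (`|d p x| * e)); last first.
        by rewrite -mulr_sumr -mulr_sumr; ring.
      have sq (y z : R) : 2 * (`|y| * z) <= y ^+ 2 + z ^+ 2.
        have := sqr_ge0 (`|y| - z); rewrite sqrrB real_normK ?num_real//.
        by lra.
      apply: lerD; last exact: sq.
      apply: ler_wpM2l => //; apply: ler_sum => q _.
      by apply: le_trans (sq _ _) _; rewrite real_normK ?num_real.
    apply: le_trans (ler_sum _ (fun p _ => step p)) _.
    have sumc (c : R) : \sum_(q < l) c = l%:R * c by rewrite sumr_const card_ord mulr_natl.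
    rewrite big_split/= -mulr_sumr big_split/= sumc.
    under eq_bigr do rewrite big_split/= sumc.
    rewrite big_split/= -mulr_sumr sumc -/(phi x).
    have h1 : 0 <= 2 * K * l%:R * e ^+ 2 by rewrite mulr_ge0 ?sqr_ge0// !mulr_ge0.
    have h2 : 0 <= l%:R * phi x by rewrite mulr_ge0.
    have h3 := sqr_ge0 e.
    rewrite /C -subr_ge0.
    apply: le_trans (addr_ge0 (addr_ge0 h1 h2) h3) _.
    by rewrite le_eqVlt; apply/orP; left; apply/eqP; ring.
  have dr x : x \in `]a, b[ -> derivable psi x 1 by move=> /dpsi[].
  by apply: (ler0_derive1_le_cc dr inn cpsi); rewrite ?in_itv/= ?lexx ?ab.
rewrite /psi -/(phi a) -/(phi b) -/C.
rewrite -(ler_pM2r (expR_gt0 (C * b))) -!mulrA -!expRD.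
rewrite mulNr addNr expR0 mulr1 => h.
apply: le_trans (_ : phi b + e ^+ 2 <= _); first by rewrite lerDl sqr_ge0.
apply: le_trans h _; rewrite le_eqVlt; apply/orP; left; apply/eqP.
by congr (_ * expR _); ring.
Qed.

End linear_ode.
End real_analysis.

Lemma cvg_mxP (R : realType) (m n : nat) (T : Type) (F : set_system T)
    {FF : Filter F} (f : T -> 'M[R]_(m, n)) (g : 'M[R]_(m, n)) :
  (f x @[x --> F] --> g) <-> forall i j, f x i j @[x --> F] --> g i j.
Proof.
split=> [fg i j|h].
  by apply: (cvg_comp f (fun M : 'M[R]_(m, n) => M i j) fg); exact: coord_continuous.
apply/cvg_ballP => e e0.
have : \forall x \near F, forall ij : 'I_m * 'I_n, ball (g ij.1 ij.2) e (f x ij.1 ij.2).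
  by apply: filter_forall => -[i j]; have /cvg_ballP/(_ e e0) := h i j.
by apply: filterS => x hx; split=> // i j; exact: (hx (i, j)).
Qed.

(** * Derivatives within a set, in particular one-sided ones *)

Section deriv_within.
Variable R : realType.

(** Once the quotient is multiplied out the condition is trivial at [s = t], so the exclusion of [t]
    from [D] disappears and such estimates can be intersected directly. *)
Lemma has_deriv_withinP (W : normedModType R) (D : set R) (f : R -> W) t v :
  has_deriv_within D f t v <->
  forall e : R, 0 < e -> \forall s \near t, D s ->
    `|f s - f t - (s - t) *: v| <= e * `|s - t|.
Proof.
have key s e : s != t ->
    (`|v - (s - t)^-1 *: (f s - f t)| <= e) =
    (`|f s - f t - (s - t) *: v| <= e * `|s - t|).
  move=> st; have st0 : s - t != 0 by rewrite subr_eq0.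
  rewrite -ler_pdivrMr ?normr_gt0// mulrC -normfV -normrZ.
  by rewrite [in RHS]scalerBr scalerA mulVf// scale1r [in RHS]distrC.
split=> [/cvgrPdist_le h e e0|h].
  have : \forall s \near t, (D `\ t) s -> `|v - (s - t)^-1 *: (f s - f t)| <= e.
    exact: h e e0.
  apply: filterS => s hs Ds.
  have [->|st] := eqVneq s t; first by rewrite !subrr scale0r subrr !normr0 mulr0.
  by rewrite -key//; apply: hs; split=> //; apply/eqP.
apply/cvgrPdist_le => e e0.
have : \forall s \near t, (D `\ t) s -> `|v - (s - t)^-1 *: (f s - f t)| <= e.
  by apply: filterS (h e e0) => s hs [Ds /eqP st]; rewrite key//; exact: hs.
by [].
Qed.

Lemma has_deriv_withinS (W : normedModType R) (D D' : set R) (f : R -> W) t v :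
  D `<=` D' -> has_deriv_within D' f t v -> has_deriv_within D f t v.
Proof.
move=> DD' /has_deriv_withinP h; apply/has_deriv_withinP => e /h.
by apply: filterS => s hs /DD' /hs.
Qed.

Lemma has_deriv_within_eq (W : normedModType R) (D : set R) (f g : R -> W) t v :
  (\forall s \near t, D s -> f s = g s) -> f t = g t ->
  has_deriv_within D f t v -> has_deriv_within D g t v.
Proof.
move=> fg fgt /has_deriv_withinP h; apply/has_deriv_withinP => e /h.
by rewrite -fgt; apply: filterS2 fg => s fs hs Ds; rewrite -fs//; exact: hs.
Qed.

Lemma has_deriv_within_cvg (W : normedModType R) (D : set R) (f : R -> W) t v :
  has_deriv_within D f t v -> f @ within D (nbhs t) --> f t.
Proof.
move=> /has_deriv_withinP /(_ 1 ltr01) h; apply/cvgrPdist_le => e e0.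
suff : \forall s \near t, D s -> `|f t - f s| <= e by [].
have K0 : 0 < 1 + `|v| by rewrite ltr_pwDl.
have : \forall s \near t, `|s - t| <= e / (1 + `|v|).
  have : \forall s \near t, `|t - s| < e / (1 + `|v|).
    by apply: (@cvgr_dist_lt _ _ _ (nbhs t) _ id t); rewrite ?divr_gt0//; exact: cvg_id.
  by apply: filterS => s /ltW; rewrite distrC.
apply: filterS2 h => s hs; rewrite ler_pdivlMr// => hst Ds.
rewrite distrC -(subrK ((s - t) *: v) (f s - f t)).
apply: le_trans (ler_normD _ _) _; rewrite normrZ.
apply: le_trans hst; rewrite mulrDr mulr1 lerD//.
by rewrite -[X in _ <= X]mul1r; exact: hs.
Qed.

Lemma has_deriv_withinB (W : normedModType R) (D : set R) (f g : R -> W) t v w :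
  has_deriv_within D f t v -> has_deriv_within D g t w ->
  has_deriv_within D (fun s => f s - g s) t (v - w).
Proof.
move=> hf hg; rewrite /has_deriv_within.
have -> : (fun s => (s - t)^-1 *: (f s - g s - (f t - g t))) =
    (fun s => (s - t)^-1 *: (f s - f t)) - (fun s => (s - t)^-1 *: (g s - g t)).
  apply/funext => s; rewrite !fctE -scalerBr; congr (_ *: _).
  by rewrite !opprB addrACA [RHS]addrACA; congr (_ + _); exact: addrC.
exact: cvgB.
Qed.

Lemma diff_dist (V W : normedModType R) (g : V -> W) x : differentiable g x ->
  forall e : R, 0 < e -> \forall y \near x, `|g y - g x - 'd g x (y - x)| <= e * `|y - x|.
Proof.
move=> dg e e0.
have /eqaddoP/(_ e e0) : g \o shift x = cst (g x) + 'd g x +o_ 0 id.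
  exact: diff_locally.
rewrite (near_shift 0 x).
apply: filterS => y /=; rewrite subr0 !fctE/= addrK.
by rewrite opprD addrA.
Qed.

Lemma has_deriv_within_comp (V W : normedModType R) (g : V -> W) (D : set R)
    (f : R -> V) t v : differentiable g (f t) ->
  has_deriv_within D f t v -> has_deriv_within D (g \o f) t ('d g (f t) v).
Proof.
move=> dg hf; have fc := has_deriv_within_cvg _ _ _ _ _ hf.
move/has_deriv_withinP : hf => hf; apply/has_deriv_withinP => e e0.
have [K K0 hK] := linear_lipschitz (diff_continuous dg).
(* One half of [e] pays for the error of [f], amplified by the Lipschitz constant [K] of the
   differential of [g]. The other half pays for the linearization error of [g], where [|f s - f t|]
   is at most [(|v| + 1) * |s - t|]; the cap 1 yields the summand 1 in this bound. *)
have e1 : 0 < Num.min 1 (e / 2 / K) by rewrite lt_min ltr01 !divr_gt0.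
have e2 : 0 < e / 2 / (`|v| + 1) by rewrite !divr_gt0// ltr_wpDl.
have h2 : \forall s \near t, D s -> `|g (f s) - g (f t) - 'd g (f t) (f s - f t)|
    <= e / 2 / (`|v| + 1) * `|f s - f t| by exact: (fc _ (diff_dist _ _ _ _ dg _ e2)).
apply: filterS2 (hf _ e1) h2 => s hs /[swap] Ds /(_ Ds) h2; have {}hs := hs Ds.
have n0 := normr_ge0 (s - t).
have ht : `|f s - f t| <= (`|v| + 1) * `|s - t|.
  rewrite -(subrK ((s - t) *: v) (f s - f t)).
  apply: le_trans (ler_normD _ _) _; rewrite normrZ mulrDl mul1r addrC mulrC lerD2l.
  apply: le_trans hs _; rewrite -[X in _ <= X]mul1r ler_wpM2r//.
  by rewrite ge_min lexx.
have -> : (g \o f) s - (g \o f) t - (s - t) *: 'd g (f t) v =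
    (g (f s) - g (f t) - 'd g (f t) (f s - f t)) +
    'd g (f t) (f s - f t - (s - t) *: v).
  by rewrite [X in _ = _ + X]linearB [X in _ = _ + (_ - X)]linearZ/= addrA subrK.
apply: le_trans (ler_normD _ _) _.
have -> : e * `|s - t| = e / 2 * `|s - t| + e / 2 * `|s - t| by field.
apply: lerD.
  apply: le_trans h2 _; rewrite -[e / 2 in leRHS](@divfK _ (`|v| + 1)) ?gt_eqF ?ltr_wpDl//.
  by rewrite -[leRHS]mulrA ler_wpM2l// ltW.
apply: le_trans (hK _) _.
apply: le_trans (ler_wpM2l (ltW K0) hs) _; rewrite mulrA ler_wpM2r//.
rewrite mulrC -ler_pdivlMr//.
by rewrite ge_min lexx orbT.
Qed.

Lemma has_deriv_within_coord (n : nat) (D : set R) (f : R -> 'rV[R]_n) t v :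
  has_deriv_within D f t v <->
  forall p, has_deriv_within D (fun s => f s 0 p : R^o) t (v 0 p).
Proof.
rewrite /has_deriv_within cvg_mxP; split=> h.
  move=> p; have := h 0 p; apply: cvg_trans; apply: near_eq_cvg; near=> s.
  by rewrite !mxE.
move=> i p; rewrite (ord1 i); have := h p; apply: cvg_trans.
by apply: near_eq_cvg; near=> s; rewrite !mxE.
Unshelve. all: by end_near. Qed.

Lemma is_derive_within (f : R -> R) (t v : R) :
  is_derive t (1 : R) f v <-> has_deriv_within setT (f : R -> R^o) t v.
Proof.
have E h : (((f \o shift t) (h *: (1 : R))) - f t) = f (h + t) - f t.
  by rewrite /= scaler1.
split.
  move=> [/cvg_ex[/= w hw] fv].
  have wv : w = v by rewrite -fv; apply/esym; exact: cvg_lim hw.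
  rewrite wv in hw => {wv}; apply/cvgrPdist_le => e e0.
  have /cvgrPdist_le/(_ e e0) := hw.
  move=> h0; suff : \forall s \near t, (setT `\ t) s -> `|v - (s - t)^-1 *: (f s - f t)| <= e by [].
  have : \forall s \near (0 : R), s != 0 -> `|v - s^-1 *: (f (s%:A + t) - f t)| <= e by exact: h0.
  rewrite (near_shift 0 t).
  apply: filterS => s /= + [_ st].
  rewrite subr0 addrK [s%:A]scaler1; apply; apply/eqP => s0; apply: st.
  by rewrite s0 subr0 add0r.
move=> /cvgrPdist_le h.
suff hc : h^-1 *: (((f \o shift t) (h *: (1 : R))) - f t) @[h --> 0^'] --> (v : R^o).
  apply: DeriveDef; first by apply/cvg_ex; exists v.
  exact: cvg_lim hc.
apply/cvgrPdist_le => e e0; have := h e e0.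
move=> h0; suff : \forall s \near (0 : R), s != 0 -> `|v - s^-1 *: (f (s%:A + t) - f t)| <= e by [].
have : \forall s \near t, (setT `\ t) s -> `|v - (s - t)^-1 *: (f s - f t)| <= e by exact: h0.
rewrite (near_shift 0 t).
apply: filterS => s /= + st; rewrite subr0 addrK [s%:A]scaler1; apply; split=> //.
by apply/eqP; rewrite -subr_eq0 addrK.
Qed.

Lemma has_deriv_within_oo a b (f : R -> R) (t v : R) : t \in `]a, b[ ->
  has_deriv_within `[a, b] (f : R -> R^o) t v -> is_derive t (1 : R) f v.
Proof.
move=> tab /has_deriv_withinP h; apply/is_derive_within/has_deriv_withinP => e e0.
have := near_in_itvoo tab.
by apply: filterS2 (h e e0) => s hs /subset_itv_oo_cc sab _; exact: hs.
Qed.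

Lemma has_deriv_within_continuous (W : normedModType R) a b (f df : R -> W) :
  (forall t, t \in `[a, b] -> has_deriv_within `[a, b] f t (df t)) ->
  {within `[a, b], continuous f}.
Proof.
move=> h; apply/subspace_continuousP => t tab.
by apply: has_deriv_within_cvg; exact: h.
Qed.

End deriv_within.

Lemma row_sum_delta_sub (R : nzRingType) n (u w : 'rV[R]_n) :
  w = u + \sum_q (w 0 q - u 0 q) *: delta_mx 0 q.
Proof.
have -> : \sum_q (w 0 q - u 0 q) *: delta_mx 0 q = w - u.
  by rewrite [RHS]row_sum_delta; apply: eq_bigr => q _; rewrite !mxE.
by rewrite addrC subrK.
Qed.

Lemma linear_form_sum (R : nzRingType) (V : lmodType R) (phi : V -> R) :
  (forall a u v, phi (a *: u + v) = a * phi u + phi v) ->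
  forall (I : Type) (r : seq I) (f : I -> R) (v : I -> V),
    phi (\sum_(q <- r) f q *: v q) = \sum_(q <- r) f q * phi (v q).
Proof.
move=> phiL I r f v.
have phi0 : phi 0 = 0.
  have := phiL 1 0 0; rewrite scale1r addr0 mul1r => /eqP.
  by rewrite -subr_eq0 opprD addNKr oppr_eq0 => /eqP.
by elim: r => [|q r IH]; rewrite ?big_nil// !big_cons phiL IH.
Qed.

Section deriv_within_more.
Variable R : realType.

Lemma has_deriv_withinD (W : normedModType R) (D : set R) (f g : R -> W) t v w :
  has_deriv_within D f t v -> has_deriv_within D g t w ->
  has_deriv_within D (fun s => f s + g s) t (v + w).
Proof.
move=> hf hg; rewrite /has_deriv_within.
have -> : (fun s => (s - t)^-1 *: (f s + g s - (f t + g t))) =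
    (fun s => (s - t)^-1 *: (f s - f t)) + (fun s => (s - t)^-1 *: (g s - g t)).
  by apply/funext => s; rewrite !fctE -scalerDr; congr (_ *: _); rewrite opprD addrACA.
exact: cvgD.
Qed.

Lemma has_deriv_within_cst (W : normedModType R) (D : set R) (a : W) t :
  has_deriv_within D (fun=> a) t 0.
Proof.
rewrite /has_deriv_within.
have -> : (fun s : R => (s - t)^-1 *: (a - a)) = fun=> 0.
  by apply/funext => s; rewrite subrr scaler0.
exact: cvg_cst.
Qed.

Lemma has_deriv_within_sum (W : normedModType R) (D : set R) (I : Type) (r : seq I)
    (f : I -> R -> W) t (v : I -> W) :
  (forall p, has_deriv_within D (f p) t (v p)) ->
  has_deriv_within D (fun s => \sum_(p <- r) f p s) t (\sum_(p <- r) v p).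
Proof.
move=> h; elim: r => [|p r IH].
  have -> : (fun s => \sum_(p <- [::]) f p s) = fun=> 0.
    by apply/funext => s; rewrite big_nil.
  by rewrite big_nil; exact: has_deriv_within_cst.
have -> : (fun s => \sum_(p <- p :: r) f p s) = fun s => f p s + \sum_(p <- r) f p s.
  by apply/funext => s; rewrite big_cons.
by rewrite big_cons; exact: has_deriv_withinD.
Qed.

(** Product rule at a zero of [f]: the term with the derivative of [g] drops out, so continuity of
    [g] at [t] within [D] is enough. *)
Lemma has_deriv_within_scale0 (W : normedModType R) (D : set R) (f : R -> R^o)
    (g : R -> W) t v : f t = 0 -> has_deriv_within D f t v ->
  g @ within D (nbhs t) --> g t ->
  has_deriv_within D (fun s => f s *: g s) t (v *: g t).
Proof.
move=> ft hf hg; rewrite /has_deriv_within.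
have -> : (fun s => (s - t)^-1 *: (f s *: g s - f t *: g t)) =
    (fun s => ((s - t)^-1 *: (f s - f t)) *: g s).
  by apply/funext => s; rewrite ft scale0r !subr0 scalerA.
apply: cvgZ; first exact: hf.
move=> B /hg hB; have {}hB : \forall s \near t, D s -> B (g s) := hB.
suff : \forall s \near t, (D `\ t) s -> B (g s) by [].
by apply: filterS hB => s hs [Ds _]; exact: hs.
Qed.

(** The zero function [f - f] would have the derivative [v - w]. This fails at any second point of
    [[a, b]] close enough to [t], and such a point exists since [a < b]: to the right of [t] if
    [t < b], to the left otherwise. *)
Lemma has_deriv_within_unique (W : normedModType R) (a b : R) (f : R -> W) t v w :
  a < b -> t \in `[a, b] ->
  has_deriv_within `[a, b] f t v -> has_deriv_within `[a, b] f t w -> v = w.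
Proof.
move=> ab tab hv hw; apply/eqP; rewrite -subr_eq0 -normr_eq0 eq_le normr_ge0 andbT.
rewrite leNgt; apply/negP => vw0.
have := has_deriv_withinB _ _ _ _ _ _ _ _ hv hw.
move=> /has_deriv_withinP/(_ _ (divr_gt0 vw0 (ltr0Sn R 1))) /nbhs_ballP[d d0 hd].
have [at_ tb] : a <= t /\ t <= b by move: tab; rewrite in_itv/= => /andP[].
have [s [sab st sd]] : exists s, [/\ s \in `[a, b], s != t & `|t - s| < d].
  have [tb'|bt] := ltP t b.
    exists (t + Num.min (d / 2) (b - t)).
    have m1 : Num.min (d / 2) (b - t) <= d / 2 by rewrite ge_min lexx.
    have m2 : Num.min (d / 2) (b - t) <= b - t by rewrite ge_min lexx orbT.
    have m0 : 0 < Num.min (d / 2) (b - t) by rewrite lt_min divr_gt0// subr_gt0.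
    split; first by rewrite in_itv/=; apply/andP; split; lra.
      by rewrite gt_eqF// ltrDl.
    by rewrite opprD addNKr normrN gtr0_norm//; lra.
  exists (t - Num.min (d / 2) (b - a)).
  have m1 : Num.min (d / 2) (b - a) <= d / 2 by rewrite ge_min lexx.
  have m2 : Num.min (d / 2) (b - a) <= b - a by rewrite ge_min lexx orbT.
  have m0 : 0 < Num.min (d / 2) (b - a) by rewrite lt_min divr_gt0// subr_gt0.
  split; first by rewrite in_itv/=; apply/andP; split; lra.
    by rewrite lt_eqF// ltrBlDr ltrDl.
  by rewrite opprB addrC subrK gtr0_norm//; lra.
have := hd s sd sab; rewrite !subrr sub0r normrN normrZ [leRHS]mulrC.
rewrite ler_pM2l ?normr_gt0 ?subr_eq0//; lra.
Qed.

End deriv_within_more.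

(** Continuous dependence on coefficients and initial values, along a filter. The limit solution [u]
    is given, the solutions [u_ k] are constructed, and Gronwall bounds their difference. *)
Lemma linear_ode_family (R : realType) (F : set_system nat) {FF : Filter F} (l : nat)
    (a b : R) (A : 'I_l -> 'I_l -> R -> R) (A_ : nat -> 'I_l -> 'I_l -> R -> R)
    (u : R -> 'rV[R]_l) (v_ : nat -> 'rV[R]_l) : a <= b ->
  (forall p q, {within `[a, b], continuous (A p q)}) ->
  (forall k p q, {within `[a, b], continuous (A_ k p q)}) ->
  (forall e : R, 0 < e -> \forall k \near F, forall p q t, t \in `[a, b] ->
     `|A_ k p q t - A p q t| <= e) ->
  (forall t, t \in `[a, b] ->
     has_deriv_within `[a, b] u t (\row_p \sum_q A p q t * u t 0 q)) ->
  v_ k @[k --> F] --> u a ->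
  exists u_ : nat -> R -> 'rV[R]_l,
    [/\ forall k, u_ k a = v_ k,
        forall k t, t \in `[a, b] ->
          has_deriv_within `[a, b] (u_ k) t (\row_p \sum_q A_ k p q t * u_ k t 0 q) &
        u_ k b @[k --> F] --> u b].
Proof.
move=> ab cA cA_ hA hu hv.
have aab : a \in `[a, b] by rewrite in_itv/= lexx.
have ex k : exists w : R -> 'rV[R]_l, w a = v_ k /\ forall t, t \in `[a, b] ->
    has_deriv_within `[a, b] w t (\row_p \sum_q A_ k p q t * w t 0 q).
  have cAc p q : continuous (A_ k p q \o clamp R a b) by exact: continuous_clamp.
  have [w [wa dw]] := linear_ode_exists R l _ (fun p => v_ k 0 p) a b ab cAc.
  exists (fun t => \row_p w p t); split; first by apply/rowP => p; rewrite mxE wa.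
  move=> t tab; apply/has_deriv_within_coord => p; rewrite mxE.
  have /is_derive_within := dw p t tab.
  move=> /(has_deriv_withinS _ _ `[a, b] _ _ _ _ (@subsetT _ _)).
  have -> : (fun s => (\row_p0 w p0 s) 0 p) = w p by apply/funext => s; rewrite mxE.
  by under eq_bigr do rewrite /= clamp_id//; under [in X in _ -> X]eq_bigr do rewrite mxE.
have [u_ hu_] := choice ex.
exists u_; split=> [k|k|]; [by case: (hu_ k)|by case: (hu_ k)|].
have cu p : {within `[a, b], continuous (fun t => u t 0 p)}.
  apply: (@has_deriv_within_continuous _ R^o _ _ _ (fun t => \sum_q A p q t * u t 0 q)).
  by move=> t tab; have /has_deriv_within_coord/(_ p) := hu t tab; rewrite mxE.
have [K K0 hK'] := continuous_bounded_itv_family R _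
  (fun pq : 'I_l * 'I_l => A pq.1 pq.2) a b ab (fun pq => cA pq.1 pq.2).
have hK p q t := hK' (p, q) t.
have [U U0 hU] := continuous_bounded_itv_family R _ (fun q t => u t 0 q) a b ab cu.
pose M := expR ((2 * (K + 1) * l%:R + 1 + l%:R) * (b - a)).
have M0 : 0 < M by exact: expR_gt0.
pose C := (l%:R + (l%:R * U) ^+ 2) * M.
have C0 : 0 <= C by rewrite mulr_ge0 ?addr_ge0 ?sqr_ge0// ltW.
apply/cvg_mxP => i p; rewrite (ord1 i); apply/cvgrPdist_le => eta eta0.
(* The cap 1 bounds the entries of [A_ k] by [K + 1], which explains [M], and gives
   [C * e ^+ 2 <= C * e]. In [C], the summand [l%:R] comes from the initial values,
   [(l%:R * U) ^+ 2] from the perturbation of the coefficients. *)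
pose e := Num.min 1 (eta ^+ 2 / (C + 1)).
have C1 : 0 < C + 1 by rewrite ltr_wpDl.
have e0 : 0 < e by rewrite lt_min ltr01 divr_gt0// exprn_gt0.
have e1 : e <= 1 by rewrite ge_min lexx.
have eC : C * e ^+ 2 <= eta ^+ 2.
  apply: le_trans (_ : C * e <= _).
    by rewrite ler_wpM2l// expr2 ler_piMl// ltW.
  apply: le_trans (_ : (C + 1) * e <= _); first by rewrite ler_wpM2r ?lerDl// ltW.
  by rewrite mulrC -ler_pdivlMr// ge_min lexx orbT.
have hv0 : \forall k \near F, forall q, `|u a 0 q - v_ k 0 q| <= e.
  apply: filter_forall => q.
  by have /cvg_mxP/(_ 0 q)/cvgrPdist_le := hv; exact.
apply: filterS2 (hA e e0) hv0 => k hAk hvk.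
have [uka duk] := hu_ k.
pose d q t := u_ k t 0 q - u t 0 q.
pose d' q t := \sum_r A_ k q r t * u_ k t 0 r - \sum_r A q r t * u t 0 r.
have dd q t : t \in `[a, b] -> has_deriv_within `[a, b] (d q : R -> R^o) t (d' q t).
  move=> tab; have /has_deriv_within_coord/(_ q) := hu t tab.
  have /has_deriv_within_coord/(_ q) := duk t tab; rewrite !mxE => h1 h2.
  exact: has_deriv_withinB h1 h2.
have sub t : t \in `]a, b[ -> t \in `[a, b] by apply: subset_itv_oo_cc.
have := @gronwall_sqr R l d d' (K + 1) (l%:R * U * e) a b ab (addr_ge0 K0 ler01).
have -> : \sum_q d q b ^+ 2 = d p b ^+ 2 + \sum_(q | q != p) d q b ^+ 2 by rewrite (bigD1 p).
move=> gw.
have {gw} : d p b ^+ 2 + \sum_(q | q != p) d q b ^+ 2 <=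
    (\sum_p d p a ^+ 2 + (l%:R * U * e) ^+ 2) * M.
  apply: gw.
  - by move=> q; apply: (@has_deriv_within_continuous _ R^o _ _ _ (d' q)) => t; exact: dd.
  - move=> q t tab; apply: (has_deriv_within_oo _ _ _ _ _ _ tab); apply: dd; exact: sub.
  - move=> q t /sub tab.
    (* The perturbation [A_ k - A] is made to act on the fixed solution [u], which is bounded by
       [U], so no bound on [u_ k] uniform in [k] is required. *)
    have -> : d' q t = \sum_r A_ k q r t * d r t + \sum_r (A_ k q r t - A q r t) * u t 0 r.
      by rewrite /d' -sumrB -big_split/=; apply: eq_bigr => r _; rewrite /d; ring.
    apply: le_trans (ler_normD _ _) _; apply: lerD; last first.
      have := @ler_norm_sum_mul R l (fun r => A_ k q r t - A q r t) (fun r => u t 0 r) e U.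
      rewrite -mulrA (mulrC U); apply=> r; [exact: hAk|exact: hU].
    apply: le_trans (ler_norm_sum _ _ _) _; rewrite mulr_sumr; apply: ler_sum => r _.
    rewrite normrM ler_wpM2r//.
    have -> : A_ k q r t = A q r t + (A_ k q r t - A q r t) by ring.
    apply: le_trans (ler_normD _ _) _; apply: lerD; first exact: hK.
    exact: le_trans (hAk _ _ _ tab) e1.
have sa : \sum_q d q a ^+ 2 <= l%:R * e ^+ 2.
  have -> : l%:R * e ^+ 2 = \sum_(q < l) e ^+ 2 by rewrite sumr_const card_ord mulr_natl.
  apply: ler_sum => q _; rewrite -real_normK ?num_real// ler_pXn2r ?nnegrE ?(ltW e0)//.
  by rewrite /d uka distrC.
have sp : 0 <= \sum_(q | q != p) d q b ^+ 2 by apply: sumr_ge0 => q _; exact: sqr_ge0.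
move=> main.
suff : d p b ^+ 2 <= eta ^+ 2.
  rewrite -real_normK ?num_real// ler_pXn2r ?nnegrE ?(ltW eta0)//.
  by rewrite /d distrC.
apply: le_trans eC; apply: le_trans (_ : (\sum_p d p a ^+ 2 + (l%:R * U * e) ^+ 2) * M <= _).
  by apply: le_trans main; rewrite lerDl.
have -> : C * e ^+ 2 = (l%:R * e ^+ 2 + (l%:R * U * e) ^+ 2) * M by rewrite /C; ring.
by rewrite ler_wpM2r ?(ltW M0)// lerD2r.
Qed.

(** * Differential calculus in charts and trivializations *)

Section C1_calculus.
Variable R : realType.

(** The differential depends only on the germ. Charts and their inverses are total functions with
    meaningful values on open sets only, so identities between coordinate expressions hold only near
    a point. *)
Lemma near_diff (V W : normedModType R) (f g : V -> W) (x : V) :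
  (\forall z \near x, f z = g z) -> differentiable f x ->
  differentiable g x /\ 'd g x = 'd f x :> (V -> W).
Proof.
move=> fg df; have dfc := diff_continuous df.
have e : f \o shift x = cst (f x) + 'd f x +o_ 0 id by exact: diff_locally.
have fgx : f x = g x := nbhs_singleton fg.
have gE : g \o shift x = cst (g x) + 'd f x +o_ 0 id.
  apply/eqaddoP => eps eps0; have /eqaddoP/(_ eps eps0) := e.
  move: fg; rewrite (near_shift 0 x); apply: filterS2 => y /= fgy.
  rewrite -fgx !fctE /=.
  by have -> : f (y + x) = g (y + x) by move: fgy; rewrite subr0.
have dg := @diff_unique R V W g ('d f x) x dfc gE.
split; last exact: dg.
by apply/diff_locallyP; rewrite dg.
Qed.

Lemma continuous_at_near (T U : topologicalType) (f g : T -> U) (x : T) :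
  (\forall z \near x, f z = g z) -> {for x, continuous f} -> {for x, continuous g}.
Proof.
move=> fg cf; rewrite /prop_for /continuous_at -(nbhs_singleton fg).
by apply: cvg_trans cf; apply: near_eq_cvg; apply: filterS fg.
Qed.

(** The point [y] is kept apart from [f x] because base points in different charts agree only
    propositionally, through [chartK]. *)
Lemma diff_comp_near (V U W : normedModType R) (f : V -> U) (g : U -> W) (h : V -> W)
    (x : V) (y : U) : f x = y -> differentiable f x -> differentiable g y ->
  (\forall z \near x, g (f z) = h z) ->
  differentiable h x /\ forall v, 'd g y ('d f x v) = 'd h x v.
Proof.
move=> <- df dg gfh.
have [dh hE] := @near_diff V W (g \o f) h x gfh (differentiable_comp df dg).
split; first exact: dh.
move=> v; rewrite hE.
exact: (esym (congr1 (fun k : V -> W => k v) (diff_comp df dg))).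
Qed.

Lemma diff_coord (V : normedModType R) m n (f : V -> 'M[R]_(m, n)) x i j :
  differentiable f x ->
  differentiable (fun z => f z i j : R^o) x /\
  forall v, 'd (fun z => f z i j : R^o) x v = ('d f x v) i j.
Proof.
move=> df.
have @L : {linear 'M[R]_(m, n) -> R^o}.
  by exists (fun N : 'M[R]_(_, _) => N i j); do 2![eexists]; do ?[constructor];
     rewrite ?mxE// => ? *; rewrite ?mxE//; move=> ?; rewrite !mxE.
have Lc : continuous L by exact: coord_continuous.
have dL : differentiable L (f x) by exact: linear_differentiable.
split; first exact: (@differentiable_comp _ _ _ _ f L x df dL).
move=> v; have := @diff_comp _ _ _ _ f L x df dL.
by rewrite (diff_lin (f x) Lc) => /(congr1 (fun h => h v)).
Qed.

Lemma differentiable_coords (V : normedModType R) n (f : V -> 'rV[R]_n) x :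
  (forall p, differentiable (fun z => f z 0 p : R^o) x) -> differentiable f x.
Proof.
move=> h.
have -> : f = \sum_(p < n) (fun z => f z 0 p *: (delta_mx 0 p : 'rV[R]_n)).
  by apply/funext => z; rewrite fct_sumE -row_sum_delta.
by apply: differentiable_sum => p; apply: differentiableZl; exact: h.
Qed.

Lemma C1_on_near (V W : normedModType R) (D : set V) (f g : V -> W) : open D ->
  (forall x, D x -> f x = g x) -> C1_on D f -> C1_on D g.
Proof.
move=> oD fg [df cf].
have fgx x : D x -> \forall z \near x, f z = g z.
  by move=> Dx; apply: filterS (open_nbhs_nbhs (conj oD Dx)) => z; exact: fg.
split=> [x Dx|v x Dx]; first by have [] := near_diff _ _ _ _ _ (fgx x Dx) (df x Dx).
have Egx y : D y -> 'd g y v = 'd f y v.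
  by move=> Dy; have [_ ->] := near_diff _ _ _ _ _ (fgx y Dy) (df y Dy).
apply: continuous_at_near (cf v x Dx).
by apply: filterS (open_nbhs_nbhs (conj oD Dx)) => z Dz; exact: (esym (Egx z Dz)).
Qed.

Lemma C1_on_subset (V W : normedModType R) (D D' : set V) (f : V -> W) :
  D `<=` D' -> C1_on D' f -> C1_on D f.
Proof. by move=> DD' [df cf]; split=> [x /DD'|v x /DD']; [exact: df|exact: cf]. Qed.

Lemma C1_on_coord (V : normedModType R) n (D : set V) (f : V -> 'rV[R]_n) : open D ->
  C1_on D f <-> forall p, C1_on D (fun z => f z 0 p : R^o).
Proof.
move=> oD; have nD x : D x -> nbhs x D by move=> Dx; exact: open_nbhs_nbhs.
split=> [[df cf] p|h].
  split=> [x Dx|v x Dx]; first by have [] := diff_coord _ _ _ _ _ 0 p (df x Dx).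
  have E y : D y -> 'd f y v 0 p = 'd (fun z => f z 0 p : R^o) y v.
    by move=> Dy; have [_ ->] := diff_coord _ _ _ _ _ 0 p (df y Dy).
  have c0 : {for x, continuous (fun y => 'd f y v 0 p)}.
    by have /cvg_mxP/(_ 0 p) := cf v x Dx.
  by apply: continuous_at_near c0; apply: filterS (nD x Dx) => z /E ->.
have df x : D x -> differentiable f x.
  by move=> Dx; apply: differentiable_coords => p; have [+ _] := h p; exact.
split=> // v x Dx; apply/cvg_mxP => i p; rewrite (ord1 i).
have E y : D y -> 'd f y v 0 p = 'd (fun z => f z 0 p : R^o) y v.
  by move=> Dy; have [_ ->] := diff_coord _ _ _ _ _ 0 p (df y Dy).
rewrite E//; have [_ /(_ v x Dx)] := h p.
apply: cvg_trans; apply: near_eq_cvg.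
by apply: filterS (nD x Dx) => z /E ->.
Qed.

Lemma C1_on_cst (V W : normedModType R) (D : set V) (a : W) : C1_on D (fun=> a).
Proof.
split=> [x Dx|v x Dx]; first exact: differentiable_cst.
have -> : (fun y => 'd (fun=> a) y v) = (fun=> 0 : W).
  by apply/funext => y; rewrite (diff_cst a y).
exact: cvg_cst.
Qed.

Lemma C1_onD (V W : normedModType R) (D : set V) (f g : V -> W) : open D ->
  C1_on D f -> C1_on D g -> C1_on D (f + g).
Proof.
move=> oD [df cf] [dg cg]; split=> [x Dx|v x Dx].
  by apply: differentiableD; [exact: df|exact: dg].
have E y : D y -> 'd f y v + 'd g y v = 'd (f + g) y v.
  by move=> Dy; exact: (esym (congr1 (fun h : V -> W => h v) (diffD (df y Dy) (dg y Dy)))).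
have c0 : {for x, continuous (fun y => 'd f y v + 'd g y v)}.
  exact: (cvgD (cf v x Dx) (cg v x Dx)).
apply: continuous_at_near c0.
by apply: filterS (open_nbhs_nbhs (conj oD Dx)) => z /E.
Qed.

Lemma C1_onM (V : normedModType R) (D : set V) (f g : V -> R^o) : open D ->
  C1_on D f -> C1_on D g -> C1_on D (fun x => f x * g x : R^o).
Proof.
move=> oD [df cf] [dg cg]; split=> [x Dx|v x Dx].
  exact: (differentiableM (df x Dx) (dg x Dx)).
have E y : D y -> f y * 'd g y v + g y * 'd f y v = 'd (fun x => f x * g x : R^o) y v.
  by move=> Dy; exact: (esym (congr1 (fun h : V -> R => h v) (diffM (df y Dy) (dg y Dy)))).
have cfx : {for x, continuous f} by apply: differentiable_continuous; exact: df.
have cgx : {for x, continuous g} by apply: differentiable_continuous; exact: dg.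
have c0 : {for x, continuous (fun y => f y * 'd g y v + g y * 'd f y v : R^o)}.
  exact: (cvgD (cvgM cfx (cg v x Dx)) (cvgM cgx (cf v x Dx))).
apply: continuous_at_near c0.
by apply: filterS (open_nbhs_nbhs (conj oD Dx)) => z /E.
Qed.

End C1_calculus.

(** * Tangent vectors, local sections and connection coefficients *)

Section bundle.
Variables (R : realType) (M : topologicalType) (m : nat) (A : C2_atlas R M m).
Variables (l : nat) (E : C1_bundle A l).
Implicit Types (i : chart_idx A) (j : triv_idx E) (y : M).

Lemma chart_inv_near i y (W : set M) : chart_dom i y -> nbhs y W ->
  \forall z \near chart i y,
    [/\ chart_dom i (chart_inv i z), chart i (chart_inv i z) = z &
        W (chart_inv i z)].
Proof.
move=> iy Wy.
have ci := @chart_inv_continuous _ _ _ A i.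
rewrite (continuous_open_subspace _ (@chart_img_open _ _ _ A i)) in ci.
have yi : (chart i @` chart_dom i) (chart i y) by exists y.
have K w : chart_dom i w -> chart_inv i (chart i w) = w.
  by move=> iw; apply: chartK; rewrite inE.
have := ci (chart i y); rewrite inE => /(_ yi); rewrite /continuous_at K//.
move=> /(_ _ Wy) h1.
have := open_nbhs_nbhs (conj (@chart_img_open _ _ _ A i) yi).
have {}h1 : \forall z \near chart i y, W (chart_inv i z) := h1.
by apply: filterS2 h1 => z Wz [w iw wE]; move: Wz; rewrite -wE; rewrite K//; split=> //; rewrite -K.
Qed.

Lemma chart_img_setI_open i (W : set M) : open W ->
  open (chart i @` (W `&` chart_dom i)).
Proof.
move=> oW; rewrite openE => _ [y [Wy iy] <-].
apply: filterS (chart_inv_near i y W iy (open_nbhs_nbhs (conj oW Wy))).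
by move=> z [iz iE Wz]; exists (chart_inv i z).
Qed.

Lemma chart_img_triv_open i j (W : set M) : open W ->
  open (chart i @` (W `&` chart_dom i `&` triv_dom j)).
Proof.
move=> oW; rewrite setIAC; apply: chart_img_setI_open.
by apply: openI => //; exact: triv_dom_open.
Qed.

Lemma diff_chart_change i i' y : chart_dom i y -> chart_dom i' y ->
  differentiable (chart i' \o chart_inv i) (chart i y).
Proof.
move=> iy iy'; have [+ _] := @chart_compat _ _ _ A i i'.
by apply; exists y.
Qed.

Lemma diff_chart_change_comp i i' i'' y v :
  chart_dom i y -> chart_dom i' y -> chart_dom i'' y ->
  'd (chart i'' \o chart_inv i') (chart i' y)
    ('d (chart i' \o chart_inv i) (chart i y) v) =
  'd (chart i'' \o chart_inv i) (chart i y) v.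
Proof.
move=> h h' h''.
have K : chart_inv i (chart i y) = y by apply: chartK; rewrite inE.
have nW : nbhs y (chart_dom i') by apply: open_nbhs_nbhs; split=> //; exact: chart_dom_open.
have e : (chart i' \o chart_inv i) (chart i y) = chart i' y by rewrite /= K.
have nz : \forall z \near chart i y, (chart i'' \o chart_inv i')
    ((chart i' \o chart_inv i) z) = (chart i'' \o chart_inv i) z.
  apply: filterS (chart_inv_near i y _ h nW) => z [_ _ iz].
  by rewrite /= chartK ?inE.
have [_ H] := diff_comp_near _ _ _ _ _ _ _ _ _ e (diff_chart_change _ _ _ h h')
  (diff_chart_change _ _ _ h' h'') nz.
exact: H.
Qed.

Lemma tangent_coord_vec i a y : chart_dom i y -> tangent y (coord_vec i a y).
Proof.
move=> iy; split=> [k k' ky ky'|k ky]; rewrite /coord_vec.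
  rewrite (asboolT ky) (asboolT ky'); apply/esym.
  exact: diff_chart_change_comp iy ky ky'.
by rewrite asboolF.
Qed.

Lemma tangent_sum (I : Type) (r : seq I) (f : I -> R)
    (X : I -> chart_idx A -> 'rV[R]_m) y :
  (forall a, tangent y (X a)) -> tangent y (\sum_(a <- r) f a *: X a).
Proof.
move=> hX; elim: r => [|a r [IH1 IH2]].
  by rewrite big_nil; split=> [k k' _ _|//]; rewrite fctE linear0.
have [hX1 hX2] := hX a.
rewrite big_cons; split=> [k k' ky ky'|k ky].
  by rewrite !fctE linearP -hX1// -IH1.
by rewrite !fctE hX2// IH2// scaler0 addr0.
Qed.

Lemma tangentE i y X : tangent y X -> chart_dom i y ->
  X = \sum_a X i 0 a *: coord_vec i a y.
Proof.
move=> [hX1 hX2] iy; apply/funext => k; rewrite fct_sumE.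
have [ky|ky] := pselect (chart_dom k y); last first.
  rewrite hX2// big1// => a _; rewrite fctE.
  by rewrite /coord_vec asboolF// scaler0.
rewrite (hX1 i k)// [X in 'd _ _ X]row_sum_delta linear_sum; apply: eq_bigr => a _.
have -> : (X i 0 a *: coord_vec i a y) k = X i 0 a *: coord_vec i a y k by [].
by rewrite /coord_vec (asboolT ky); exact: linearZ.
Qed.

Lemma C1_fun_cst (W : set M) (a : R) : C1_fun_on A W (fun=> a).
Proof. by move=> i; exact: C1_on_cst. Qed.

Lemma tderiv_cst i a y X : tderiv i (fun=> a) y X = 0.
Proof. by rewrite /tderiv (diff_cst (a : R^o) (chart i y)). Qed.

Lemma C1_section_triv_inv j v y : triv_dom j y ->
  C1_section_near y (fun z => triv_inv j z v : E z).
Proof.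
move=> jy; exists (triv_dom j); first by split=> //; exact: triv_dom_open.
move=> i j'; have := triv_compat i j j' v.
by rewrite (setIC (triv_dom j)).
Qed.

Lemma C1_section_nearD y (s s' : forall z, E z) :
  C1_section_near y s -> C1_section_near y s' ->
  C1_section_near y (fun z => s z + s' z).
Proof.
move=> [W [oW Wy] hs] [W' [oW' Wy'] hs'].
exists (W `&` W'); first by split; [exact: openI|split].
move=> i j; have oI := chart_img_triv_open i j _ (openI oW oW').
apply: C1_on_near oI _ (C1_onD _ _ _ _ _ _ oI _ _); last 2 first.
- by apply: C1_on_subset (hs i j) => _ [z [[[? ?] ?] ?] <-]; exists z.
- by apply: C1_on_subset (hs' i j) => _ [z [[[? ?] ?] ?] <-]; exists z.
- by move=> z _; rewrite linearD.
Qed.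

Lemma C1_section_nearZ y (f : M -> R) (s : forall z, E z) (W0 : set M) :
  open_nbhs y W0 -> C1_fun_on A W0 f -> C1_section_near y s ->
  C1_section_near y (fun z => f z *: s z).
Proof.
move=> [oW0 Wy0] hf [W [oW Wy] hs].
exists (W0 `&` W); first by split; [exact: openI|split].
move=> i j; have oI := chart_img_triv_open i j _ (openI oW0 oW).
apply/C1_on_coord => // p.
apply: C1_on_near oI _ (C1_onM _ _ _ _ _ oI _ _); last 2 first.
- by apply: C1_on_subset (hf i) => _ [z [[[? ?] ?] ?] <-]; exists z.
- have /C1_on_coord/(_ p) := hs i j; move=> /(_ (chart_img_triv_open i j _ oW)).
  by apply: C1_on_subset => _ [z [[[? ?] ?] ?] <-]; exists z.
- by move=> z _; rewrite /= linearZ mxE.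
Qed.

Lemma C1_section_near0 y : C1_section_near y (fun z => 0 : E z).
Proof.
exists setT; first by split=> //; exact: openT.
move=> i j; have oI := chart_img_triv_open i j _ openT.
by apply: C1_on_near oI _ (C1_on_cst _ _ _ _ (0 : 'rV[R]_l)) => z _; rewrite linear0.
Qed.

Lemma C1_section_near_sum (I : Type) (r : seq I) y (s : I -> forall z, E z) :
  (forall p, C1_section_near y (s p)) ->
  C1_section_near y (fun z => \sum_(p <- r) s p z).
Proof.
move=> hs; elim: r => [|p r IH].
  have -> : (fun z => \sum_(p <- [::]) s p z) = (fun z => 0 : E z).
    by apply: functional_extensionality_dep => z; rewrite big_nil.
  exact: C1_section_near0.
have -> : (fun z => \sum_(p0 <- p :: r) s p0 z) =
    (fun z => s p z + \sum_(p0 <- r) s p0 z).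
  by apply: functional_extensionality_dep => z; rewrite big_cons.
exact: (C1_section_nearD y (s p) _ (hs p) IH).
Qed.

Section connection.
Variable D : C0_connection E.

(** Let [f] be the indicator function of an open [W0] on which the sections agree. Then [f z *: s z]
    and [f z *: s' z] coincide everywhere, and the Leibniz rule with [f y = 1] and zero derivative
    of [f] removes [f] again. As [C1_fun_on] is asked on [W0] only, where [f] is constant, a bump
    function is avoided. *)
Lemma nabla_germ y X (s s' : forall z, E z) : tangent y X ->
  C1_section_near y s -> C1_section_near y s' ->
  (\forall z \near y, s z = s' z) -> D y X s = D y X s'.
Proof.
move=> tX hs hs'; move=> nss'.
have : nbhs y (fun z => s z = s' z) := nss'.
rewrite nbhsE => -[W0 [oW0 Wy0] ss'].
have [i iy] := @chart_cover _ _ _ A y.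
pose f z : R := (`[< W0 z >])%:R.
have f1 z : W0 z -> f z = 1 by move=> Wz; rewrite /f asboolT.
have K i' w : chart_dom i' w -> chart_inv i' (chart i' w) = w.
  by move=> iw; apply: chartK; rewrite inE.
have fC : C1_fun_on A W0 f.
  move=> i'; apply: C1_on_near (chart_img_setI_open i' _ oW0) _
    (C1_on_cst _ _ _ _ (1 : R^o)) => _ [w [Ww iw] <-].
  by rewrite /= K// f1.
have tf : tderiv i f y X = 0.
  rewrite -(tderiv_cst i 1 y X) /tderiv.
  have [|_] := @near_diff R 'rV[R]_m R^o (fun=> 1) (f \o chart_inv i) (chart i y) _
    (@differentiable_cst _ _ _ (1 : R^o) (chart i y)); last by move=> ->.
  apply: filterS (chart_inv_near i y _ iy (open_nbhs_nbhs (conj oW0 Wy0))).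
  by move=> z [_ _ Wz] /=; rewrite f1.
have fC' : exists2 W, open_nbhs y W & C1_fun_on A W f by exists W0.
have := nabla_leibniz D tX fC' hs iy.
have := nabla_leibniz D tX fC' hs' iy.
have -> : (fun z => f z *: s z) = (fun z => f z *: s' z).
  apply: functional_extensionality_dep => z.
  have [Wz|nWz] := pselect (W0 z); first by rewrite ss'.
  by rewrite /f asboolF// !scale0r.
by rewrite tf f1// !scale0r !scale1r !add0r => <- <-.
Qed.

Lemma nabla_linear_sum (I : Type) (r : seq I) (f : I -> R)
    (X : I -> chart_idx A -> 'rV[R]_m) y s : (forall a, tangent y (X a)) ->
  C1_section_near y s ->
  D y (\sum_(a <- r) f a *: X a) s = \sum_(a <- r) f a *: D y (X a) s.
Proof.
move=> hX hs; elim: r => [|a r IH].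
  rewrite !big_nil.
  have t0 : @tangent R M m A y 0.
    by split=> [k k' _ _|//]; rewrite fctE linear0.
  have := nabla_linear D 1 t0 t0 hs; rewrite !scale1r addr0.
  by move=> /eqP; rewrite -subr_eq0 opprD addNKr oppr_eq0 => /eqP.
by rewrite !big_cons nabla_linear// ?IH//; exact: tangent_sum.
Qed.

Lemma nabla_sum (I : Type) (r : seq I) (s : I -> forall z, E z) y X :
  tangent y X -> (forall p, C1_section_near y (s p)) ->
  D y X (fun z => \sum_(p <- r) s p z) = \sum_(p <- r) D y X (s p).
Proof.
move=> tX hs; elim: r => [|p r IH].
  have -> : (fun z => \sum_(p <- [::]) s p z) = (fun z => 0 : E z).
    by apply: functional_extensionality_dep => z; rewrite big_nil.
  have h0 := C1_section_near0 y.
  have := nabla_additive D tX h0 h0.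
  have -> : (fun z => 0 + 0 : E z) = (fun z => 0).
    by apply: functional_extensionality_dep => z; rewrite addr0.
  by move=> /eqP; rewrite -subr_eq0 opprD addNKr oppr_eq0 big_nil => /eqP.
have -> : (fun z => \sum_(p0 <- p :: r) s p0 z) =
    (fun z => s p z + \sum_(p0 <- r) s p0 z).
  by apply: functional_extensionality_dep => z; rewrite big_cons.
by rewrite nabla_additive// ?IH ?big_cons//; exact: C1_section_near_sum.
Qed.

(** Homogeneity under real scalars comes from the Leibniz rule for constant functions. *)
Lemma nabla_triv_inv j v y X : tangent y X -> triv_dom j y ->
  D y X (fun z => triv_inv j z v) =
  \sum_q v 0 q *: D y X (fun z => triv_inv j z (delta_mx 0 q)).
Proof.
move=> tX jy; have [i iy] := @chart_cover _ _ _ A y.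
have oT : open_nbhs y [set: M] by split=> //; exact: openT.
have hs q := C1_section_triv_inv j (delta_mx 0 q) y jy.
have cC (a : R) : exists2 W, open_nbhs y W & C1_fun_on A W (fun=> a).
  by exists setT => //; exact: C1_fun_cst.
have -> : (fun z => triv_inv j z v) =
    (fun z => \sum_q v 0 q *: triv_inv j z (delta_mx 0 q)).
  apply: functional_extensionality_dep => z.
  rewrite {1}(row_sum_delta v) linear_sum; apply: eq_bigr => q _.
  by rewrite linearZ.
have hvs q : C1_section_near y (fun z => v 0 q *: triv_inv j z (delta_mx 0 q)).
  exact: C1_section_nearZ oT (C1_fun_cst setT (v 0 q)) (hs q).
rewrite (nabla_sum _ _ (fun q z => v 0 q *: triv_inv j z (delta_mx 0 q)) y X tX hvs).
apply: eq_bigr => q _.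
by rewrite (nabla_leibniz D tX (cC (v 0 q)) (hs q) iy) tderiv_cst scale0r add0r.
Qed.

(** For [X] a velocity, the inner sum is, up to sign, the coefficient matrix of the linear equation
    of parallel transport. *)
Lemma nabla_conn_coef i j v y X p : tangent y X -> chart_dom i y -> triv_dom j y ->
  (triv j y (D y X (fun z => triv_inv j z v)) : 'rV[R]_l) 0 p =
  \sum_q (\sum_a X i 0 a * conn_coef D i j a p q y) * v 0 q.
Proof.
move=> tX iy jy; rewrite nabla_triv_inv// linear_sum summxE.
apply: eq_bigr => q _; rewrite linearZ mxE mulrC; congr (_ * _).
rewrite {1}(tangentE i y X tX iy) nabla_linear_sum; last 2 first.
- by move=> a; exact: tangent_coord_vec.
- exact: C1_section_triv_inv.
by rewrite linear_sum summxE; apply: eq_bigr => a _; rewrite linearZ mxE.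
Qed.

End connection.
End bundle.

(** * Parallel transport along curves *)

Section parallel_transport.
Variables (R : realType) (M : topologicalType) (m : nat) (A : C2_atlas R M m).
Variables (l : nat) (E : C1_bundle A l).

(* Covariant derivatives along a curve may be computed in a single
   trivialization: the derivative of the transition function is cancelled by
   the Leibniz rule for the change of frame. *)
Lemma cov_deriv_triv_change (D : C0_connection E) (I : set R) (c : R -> M)
    (s : forall t, E (c t)) t X i j0 j :
  c @ within I (nbhs t) --> c t -> tangent (c t) X -> chart_dom i (c t) ->
  has_deriv_within I (chart i \o c) t (X i) ->
  triv_dom j0 (c t) -> triv_dom j (c t) ->
  has_deriv_within I (fun r => triv j0 (c r) (s r) : 'rV[R]_l) t
    (- triv j0 (c t) (D (c t) X (fun y => triv_inv j0 y (triv j0 (c t) (s t))))) ->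
  has_deriv_within I (fun r => triv j (c r) (s r) : 'rV[R]_l) t
    (- triv j (c t) (D (c t) X (fun y => triv_inv j y (triv j (c t) (s t))))).
Proof.
move=> cc tX iy hX j0y jy; set u0 : 'rV[R]_l := triv j0 (c t) (s t).
set u : 'rV[R]_l := triv j (c t) (s t); set v0 : 'rV[R]_l := - triv _ _ _.
move=> hu0.
pose G v z : 'rV[R]_l := triv j (chart_inv i z) (triv_inv j0 (chart_inv i z) v).
pose k r := chart i (c r).
have K w : chart_dom i w -> chart_inv i (chart i w) = w.
  by move=> iw; apply: chartK; rewrite inE.
have dG v : differentiable (G v) (k t).
  by have [+ _] := triv_compat i j0 j v; apply; exists (c t).
have dGk v : has_deriv_within I (G v \o k) t ('d (G v) (k t) (X i)).
  exact: has_deriv_within_comp (dG v) hX.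
(* The section in the trivialization [j], with its coordinates in [j0] expanded around their value
   [u0] at [t]. The factors in the sum vanish at [t], so [has_deriv_within_scale0] applies to each
   term. *)
pose U r : 'rV[R]_l := (G u0 \o k) r +
  \sum_q ((triv j0 (c r) (s r) : 'rV[R]_l) 0 q - u0 0 q) *: (G (delta_mx 0 q) \o k) r.
have oW : open_nbhs (c t) (triv_dom j0 `&` triv_dom j).
  by split; [apply: openI; exact: triv_dom_open|].
have Uu : \forall r \near t, I r -> U r = triv j (c r) (s r).
  have n1 : nbhs (c t) (chart_dom i).
    by apply: open_nbhs_nbhs; split=> //; exact: chart_dom_open.
  have n2 : nbhs (c t) (chart_dom i `&` (triv_dom j0 `&` triv_dom j)).
    by apply: filterI n1 _; exact: open_nbhs_nbhs.
  have hcc : \forall r \near t, I r -> chart_dom i (c r) /\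
    (triv_dom j0 (c r) /\ triv_dom j (c r)) := cc _ n2.
  apply: filterS hcc => r hr Ir.
  have [ir [j0r jr]] := hr Ir.
  rewrite /U /= /G /k K// -[in RHS](@trivK _ _ _ _ _ E j0 (c r) j0r (s r)).
  set w : 'rV[R]_l := triv j0 (c r) (s r).
  rewrite [in RHS](row_sum_delta_sub _ _ u0 w) linearD linearD; congr (_ + _).
  rewrite linear_sum linear_sum; apply: eq_bigr => q _.
  by rewrite linearZ linearZ.
have Ut : U t = triv j (c t) (s t).
  rewrite /U big1 ?addr0; last by move=> q _; rewrite subrr scale0r.
  by rewrite /= /G /k K// /u0 trivK.
have hU : has_deriv_within I U t ('d (G u0) (k t) (X i) +
    \sum_q v0 0 q *: G (delta_mx 0 q) (k t)).
  apply: has_deriv_withinD; first exact: dGk.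
  apply: has_deriv_within_sum => q.
  apply: has_deriv_within_scale0; first by rewrite subrr.
    have /has_deriv_within_coord/(_ q) h := hu0.
    have h0 := has_deriv_within_cst _ R^o I (u0 0 q) t.
    by have := has_deriv_withinB _ _ _ _ _ _ _ _ h h0; rewrite subr0.
  exact: has_deriv_within_cvg (dGk _).
have {hU} := has_deriv_within_eq _ _ _ _ _ _ _ Uu Ut hU.
congr has_deriv_within.
have -> : \sum_q v0 0 q *: G (delta_mx 0 q) (k t) = triv j (c t) (triv_inv j0 (c t) v0).
  rewrite {2}(row_sum_delta v0) linear_sum linear_sum; apply: eq_bigr => q _.
  by rewrite linearZ linearZ /G /k K.
rewrite /v0 linearN linearN trivK//.
(* What remains is the change-of-frame formula: the derivative of the transition function is the
   inhomogeneous term relating the two coordinate expressions of the connection. *)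
suff -> : triv j (c t) (D (c t) X (fun y => triv_inv j0 y u0)) =
    'd (G u0) (k t) (X i) + triv j (c t) (D (c t) X (fun y => triv_inv j y u)).
  by rewrite opprD addrA subrr add0r.
pose Fp p z : R := (triv j z (triv_inv j0 z u0) : 'rV[R]_l) 0 p.
have FC p : exists2 W, open_nbhs (c t) W & C1_fun_on A W (Fp p).
  exists (triv_dom j0 `&` triv_dom j) => // i'.
  have := triv_compat i' j0 j u0; rewrite -setIA setIC => h.
  have /C1_on_coord/(_ p) := h; apply.
  by apply: chart_img_setI_open; case: oW.
have he p := C1_section_triv_inv _ _ _ _ _ E j (delta_mx 0 p) (c t) jy.
have hFe p : C1_section_near (c t) (fun z => Fp p z *: triv_inv j z (delta_mx 0 p)).
  have [W oW' hW] := FC p.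
  exact: C1_section_nearZ oW' hW (he p).
(* The section constant in the frame [j0] equals its expansion in the frame [j] only over the
   overlap of the two domains, hence the appeal to locality. *)
rewrite (nabla_germ _ _ _ _ _ E D (c t) X _ _ tX
  (C1_section_triv_inv _ _ _ _ _ E j0 u0 (c t) j0y)
  (C1_section_near_sum _ _ _ _ _ E _ (index_enum 'I_l) (c t) _ hFe)); last first.
  apply: filterS (open_nbhs_nbhs oW) => z [j0z jz].
  rewrite -{1}(@trivK _ _ _ _ _ E j z jz (triv_inv j0 z u0)).
  rewrite {1}(row_sum_delta (triv j z (triv_inv j0 z u0))) linear_sum.
  by apply: eq_bigr => p _; rewrite linearZ.
rewrite (nabla_sum _ _ _ _ _ E D _ _
  (fun p z => Fp p z *: triv_inv j z (delta_mx 0 p)) (c t) X tX hFe).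
rewrite (eq_bigr (fun p => tderiv i (Fp p) (c t) X *: triv_inv j (c t) (delta_mx 0 p) +
   u 0 p *: D (c t) X (fun z => triv_inv j z (delta_mx 0 p)))); last first.
  move=> p _; rewrite (nabla_leibniz D tX (FC p) (he p) iy).
  by rewrite /Fp /u0 trivK.
rewrite big_split linearD/= (nabla_triv_inv _ _ _ _ _ E D j u (c t) X tX jy); congr (_ + _).
rewrite linear_sum [RHS]row_sum_delta; apply: eq_bigr => p _.
rewrite linearZ/= triv_invK//; congr (_ *: _).
by have [_ <-] := diff_coord _ _ _ _ _ _ 0 p (dG u0).
Qed.

End parallel_transport.

(** * Subdivisions of an interval and passage from local to global *)

Section chains.
Variable R : realType.
Implicit Types (P Q : R -> R -> Prop) (a b c : R).

(** The subdivision inside [parallel], freed from the end points 0 and 1 so that pieces can be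
    concatenated. Having at least one piece forces [a < b]. *)
Definition chain Q a b := exists n t,
  [/\ (0 < n)%N, t 0%N = a, t n = b &
      forall k, (k < n)%N -> t k < t k.+1 /\ Q (t k) (t k.+1)].

Lemma chain1 Q a b : a < b -> Q a b -> chain Q a b.
Proof.
move=> ab qab; exists 1%N, (fun k => if k is 0%N then a else b).
by split=> // -[|].
Qed.

Lemma chain_trans Q a b c : chain Q a b -> chain Q b c -> chain Q a c.
Proof.
move=> [n [t [n0 ta tb hQ]]] [n' [t' [n0' tb' tc hQ']]].
exists (n + n')%N, (fun k => if (k <= n)%N then t k else t' (k - n)%N).
split; first by rewrite addn_gt0 n0.
- by [].
- by rewrite (_ : (n + n' <= n)%N = false) ?addKn//; lia.
- move=> k kn; have [kn'|nk] := ltnP k n; first by rewrite ltnW//; exact: hQ.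
  rewrite (_ : (if (k <= n)%N then _ else _) = t' (k - n)%N).
    by rewrite subSn//; apply: hQ'; rewrite ltn_subLR.
  have [->|kn'] := eqVneq k n; first by rewrite leqnn subnn tb tb'.
  by rewrite (_ : (k <= n)%N = false)//; lia.
Qed.

Lemma chain_mono Q n (t : nat -> R) :
  (forall k, (k < n)%N -> t k < t k.+1 /\ Q (t k) (t k.+1)) ->
  forall i j, (i <= j <= n)%N -> t i <= t j.
Proof.
move=> h i j /andP[/subnK<-]; elim: (j - i)%N => // d IH hd.
apply: le_trans (IH (ltnW hd)) _; rewrite addSn.
by apply: ltW; have [] := h _ hd.
Qed.

Lemma chain_imp P Q a b :
  (forall x y, a <= x -> x < y -> y <= b -> P x y -> Q x y) ->
  chain P a b -> chain Q a b.
Proof.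
move=> PQ [n [t [n0 ta tb h]]]; exists n, t; split=> // k kn.
have [tk Pk] := h k kn; split=> //; apply: PQ => //.
  by rewrite -ta; apply: (chain_mono _ _ _ h); rewrite leq0n ltnW.
by rewrite -tb; apply: (chain_mono _ _ _ h); rewrite kn leqnn.
Qed.

Lemma chain_ind P a b : (forall x y z, x < y -> y < z -> P x y -> P y z -> P x z) ->
  chain P a b -> P a b.
Proof.
move=> Ptr [n [t [n0 <- <- h]]].
suff : forall k, (0 < k <= n)%N -> t 0%N < t k /\ P (t 0%N) (t k).
  by move=> /(_ n); rewrite n0 leqnn => /(_ isT)[].
elim=> // k IH kn; have [tk Pk] := h k kn.
case: k IH kn tk Pk => // k IH kn tk Pk.
have [t0 P0] : t 0%N < t k.+1 /\ P (t 0%N) (t k.+1).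
  by apply: IH; move: kn; rewrite !ltnS !leq0n /= => /ltnW.
by split; [exact: lt_trans tk|exact: Ptr P0 Pk].
Qed.

(** Compactness of [[a, b]] in the form of a supremum argument: near the supremum of the points
    reached from [a], the local hypothesis extends [P] beyond it unless it is [b]. *)
Lemma interval_chain_ind P a b : a < b ->
  (forall x y z, x < y -> y < z -> P x y -> P y z -> P x z) ->
  (forall t, t \in `[a, b] -> exists2 d, 0 < d & forall x y, a <= x -> x < y ->
     y <= b -> t - d < x -> y < t + d -> P x y) ->
  P a b.
Proof.
move=> ab Ptr loc.
(* The alternative [x = a] makes [S] nonempty, since [P] is available only on nondegenerate
   intervals. *)
pose S := [set x | a <= x <= b /\ (x = a \/ P a x)].
have Sa : S a by split; [rewrite lexx ltW|left].
have Sb : ubound S b by move=> x [/andP[]].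
have hs : has_sup S by split; [exists a|exists b].
have s1 : a <= sup S by apply: ub_le_sup => //; exists b.
have s2 : sup S <= b by apply: ge_sup => //; exists a.
have [d d0 hd] : exists2 d, 0 < d & forall x y, a <= x -> x < y ->
     y <= b -> sup S - d < x -> y < sup S + d -> P x y.
  by apply: loc; rewrite in_itv/= s1 s2.
have [x Sx xs] := sup_adherent d0 hs.
have xS : x <= sup S by apply: ub_le_sup => //; exists b.
have [/andP[ax xb] Px] := Sx.
(* A point beyond the supremum, capped at [b]. Since [y] turns out to lie in [S], the cap must be
   attained. *)
pose y := Num.min b (sup S + d / 2).
have yb : y <= b by rewrite ge_min lexx.
have ys : y <= sup S + d / 2 by rewrite ge_min lexx orbT.
have d2 : 0 < d / 2 by rewrite divr_gt0.
have Py : S y.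
  have [xy|yx] := ltP x y.
    have Pxy : P x y by apply: hd => //; lra.
    split; first by rewrite yb andbT ltW// (le_lt_trans ax xy).
    case: Px => [xa|Pax]; first by right; rewrite -xa.
    have [xa|xa] := eqVneq x a; first by right; rewrite -xa.
    by right; apply: (Ptr _ x) => //; rewrite lt_neqAle eq_sym xa.
  have yx' : y = x.
    apply/eqP; rewrite eq_le yx /=.
    rewrite /y le_min xb /=; lra.
  by rewrite yx'.
have yE : y = b.
  have yS : y <= sup S by apply: ub_le_sup => //; exists b.
  move: yS; rewrite /y minElt; case: ifP => // _; lra.
by move: Py => [_]; rewrite yE => -[ba|//]; rewrite ba ltxx in ab.
Qed.

End chains.

(** * Parallel sections along a curve and their dependence on the connection *)

Section curves.
Variables (R : realType) (M : topologicalType) (m : nat) (A : C2_atlas R M m).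
Variables (l : nat) (E : C1_bundle A l).

Lemma velocity_subset (D D' : set R) (c : R -> M) t X : D `<=` D' ->
  velocity (A:=A) D' c t X -> velocity D c t X.
Proof.
move=> DD' [tX hX]; split=> // i ic.
exact: has_deriv_withinS DD' (hX i ic).
Qed.

Lemma velocity_unique a b (c : R -> M) t X X' : a < b -> t \in `[a, b] ->
  velocity (A:=A) `[a, b] c t X -> velocity `[a, b] c t X' -> X = X'.
Proof.
move=> ab tab [tX hX] [tX' hX']; apply/funext => i.
have [ic|ic] := pselect (chart_dom i (c t)); last by rewrite tX.2// tX'.2.
exact: has_deriv_within_unique ab tab (hX i ic) (hX' i ic).
Qed.

Lemma subset_itvcc (a a' b' b : R) : a <= a' -> b' <= b -> `[a', b'] `<=` `[a, b].
Proof.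
move=> aa bb x /=; rewrite !in_itv/= => /andP[ax xb].
by rewrite (le_trans aa ax) (le_trans xb bb).
Qed.

Lemma C1_curve_subset (a b a' b' : R) (c : R -> M) : a <= a' -> b' <= b ->
  C1_curve A a b c -> C1_curve A a' b' c.
Proof.
move=> aa bb [cc [cdot [hv hc]]]; have sub := subset_itvcc _ _ _ _ aa bb.
split; first exact: continuous_subspaceW sub cc.
exists cdot; split=> [t /sub tab|i]; first exact: velocity_subset sub (hv t tab).
by apply: continuous_subspaceW (hc i) => t [/sub].
Qed.

Definition parallel_on (D : C0_connection E) (c : R -> M) (s : forall t, E (c t))
    (a b : R) :=
  C1_curve A a b c /\ forall r X, r \in `[a, b] ->
    velocity `[a, b] c r X -> cov_deriv D `[a, b] s X (0 : E (c r)).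

(** The condition on the smaller interval concerns every velocity within that interval. As
    [a' < b'], such a velocity is unique and hence is the restriction of the one on [[a, b]]. *)
Lemma parallel_on_subset (D : C0_connection E) c s (a b a' b' : R) : a <= a' ->
  a' < b' -> b' <= b -> parallel_on D c s a b -> parallel_on D c s a' b'.
Proof.
move=> aa ab bb [C1c hs]; split; first exact: C1_curve_subset C1c.
have sub := subset_itvcc _ _ _ _ aa bb.
have [_ [cdot [hv _]]] := C1c.
move=> r X rab vX j jr.
have rab' : r \in `[a, b] by exact: sub.
have XE := velocity_unique _ _ _ _ _ _ ab rab vX (velocity_subset _ _ _ _ _ sub (hv r rab')).
rewrite XE.
exact: has_deriv_withinS sub (hs r (cdot r) rab' (hv r rab') j jr).
Qed.

Lemma parallel_on_eq (D : C0_connection E) c (s s' : forall t, E (c t)) (a b : R) :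
  (forall t, t \in `[a, b] -> s t = s' t) ->
  parallel_on D c s a b -> parallel_on D c s' a b.
Proof.
move=> ss' [C1c hs]; split=> // r X rab vX j jr.
rewrite -ss'//; apply: has_deriv_within_eq (hs r X rab vX j jr).
  have H t : `[a, b]%classic t -> triv j (c t) (s t) = triv j (c t) (s' t).
    by move=> tab; rewrite ss'.
  exact: (@filterE _ _ (nbhs_filter r) _ H).
by rewrite ss'.
Qed.

Lemma parallelP (D : C0_connection E) c s :
  parallel D s <-> chain R (parallel_on D c s) 0 1.
Proof.
split=> [[n [t [[t0 t1 tk] h]]]|[n [t [n0 t0 t1 h]]]].
  exists n, t; split=> //; last by move=> k kn; split; [exact: tk|exact: h].
  by case: n t1 {tk h} => //; rewrite t0 => /eqP; rewrite eq_sym oner_eq0.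
by exists n, t; split=> [|k /h[]//]; split=> // k /h[].
Qed.

(* The fibres carry no topology: convergence is tested on linear forms. *)
Definition cvg_fibre (F : set_system nat) (y : M) (e_ : nat -> E y) (e : E y) :=
  forall phi : E y -> R, (forall a u v, phi (a *: u + v) = a * phi u + phi v) ->
    phi (e_ k) @[k --> F] --> phi e.

Lemma cvg_fibreP (F : set_system nat) {FF : Filter F} y (e_ : nat -> E y) e j :
  triv_dom j y ->
  cvg_fibre F y e_ e <-> (triv j y (e_ k) : 'rV[R]_l) @[k --> F] --> (triv j y e : 'rV[R]_l).
Proof.
move=> jy; split=> h.
  apply/cvg_mxP => i p; rewrite (ord1 i).
  apply: (h (fun v => (triv j y v : 'rV[R]_l) 0 p)) => a u v.
  by rewrite linearP !mxE.
move=> phi phiL.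
have phiE v : phi v = \sum_q (triv j y v : 'rV[R]_l) 0 q * phi (triv_inv j y (delta_mx 0 q)).
  rewrite -{1}(trivK jy v) {1}(row_sum_delta (triv j y v)) linear_sum.
  rewrite -(linear_form_sum _ _ _ phiL).
  by congr phi; apply: eq_bigr => q _; rewrite linearZ.
rewrite phiE; under eq_cvg do rewrite phiE.
apply: cvg_sumr => q; apply: (@cvgM R); last exact: cvg_cst.
by have /cvg_mxP/(_ 0 q) := h.
Qed.

Lemma C0_converges_near (D_ : nat -> C0_connection E) (D : C0_connection E)
    (i : chart_idx A) (j : triv_idx E) (K : set M) (e : R) : C0_converges D_ D -> compact K ->
  K `<=` chart_dom i `&` triv_dom j -> 0 < e ->
  \forall k \near \oo, forall a p q y, K y ->
    `|conn_coef (D_ k) i j a p q y - conn_coef D i j a p q y| <= e.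
Proof.
move=> DD cK Kij e0.
have h (apq : 'I_m * 'I_l * 'I_l) : \forall k \near \oo, forall y, K y ->
    `|conn_coef (D_ k) i j apq.1.1 apq.1.2 apq.2 y
      - conn_coef D i j apq.1.1 apq.1.2 apq.2 y| <= e.
  have hU := DD i j K cK Kij apq.1.1 apq.1.2 apq.2.
  have hP : nbhs (cst (0 : R) : {uniform` K -> R})
      [set f : M -> R | forall y, K y -> ball (0 : R) e (f y)].
    apply/uniform_nbhs; exists [set xy | ball xy.1 e xy.2]; split.
      exact: (entourage_ball _ (PosNum e0)).
    by move=> f.
  have hk0 : \forall k \near \oo, forall y, K y -> ball (0 : R) e
     (conn_coef (D_ k) i j apq.1.1 apq.1.2 apq.2 y
      - conn_coef D i j apq.1.1 apq.1.2 apq.2 y) := hU _ hP.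
  apply: filterS hk0 => k hk y Ky.
  by have := hk y Ky; rewrite -ball_normE /= sub0r normrN => /ltW.
have {}h : \forall k \near \oo, forall (apq : 'I_m * 'I_l * 'I_l) y, K y ->
    `|conn_coef (D_ k) i j apq.1.1 apq.1.2 apq.2 y
      - conn_coef D i j apq.1.1 apq.1.2 apq.2 y| <= e.
  exact: filter_forall.
apply: filterS h => k hk a p q y Ky; exact: (hk (a, p, q)).
Qed.

Lemma within_continuous_comp_curve (T U : topologicalType) (c : R -> T) (f : T -> U)
    (I : set R) (W : set T) : {within I, continuous c} -> {within W, continuous f} ->
  (forall t, I t -> W (c t)) -> {within I, continuous (f \o c)}.
Proof.
move=> /subspace_continuousP cc /subspace_continuousP cf IW.
apply/subspace_continuousP => t It B hB.
have h1 : \forall y \near c t, W y -> B (f y) := cf (c t) (IW t It) B hB.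
have h2 : \forall r \near t, I r -> W (c r) -> B (f (c r)) := cc t It _ h1.
suff : \forall r \near t, I r -> B (f (c r)) by [].
by apply: filterS h2 => r hr Ir; exact: hr (IW r Ir).
Qed.

(** Over one chart and one trivialization the parallel sections solve a linear equation, and
    [linear_ode_family] applies to their coordinates. *)
Lemma parallel_transport_local (F : set_system nat) {FF : Filter F}
    (D_ : nat -> C0_connection E) (D : C0_connection E) (c : R -> M)
    (s : forall t, E (c t)) (a b : R) (i : chart_idx A) (j : triv_idx E) (e_ : nat -> E (c a)) :
  F `=>` \oo -> C0_converges D_ D -> a < b -> parallel_on D c s a b ->
  (forall t, t \in `[a, b] -> chart_dom i (c t) /\ triv_dom j (c t)) ->
  cvg_fibre F (c a) e_ (s a) ->
  exists s_ : nat -> forall t, E (c t),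
    [/\ forall k, s_ k a = e_ k, forall k, parallel_on (D_ k) c (s_ k) a b &
        cvg_fibre F (c b) (fun k => s_ k b) (s b)].
Proof.
move=> Foo DD ab [C1c hs] hij he.
have [cc [cdot [hv hc]]] := C1c.
have aab : a \in `[a, b] by rewrite in_itv/= lexx ltW.
have bab : b \in `[a, b] by rewrite in_itv/= lexx ltW.
have ccd : {within `[a, b], continuous (fun t => cdot t i)}.
  by apply: continuous_subspaceW (hc i) => t tab; split=> //=; case: (hij t tab).
(* The matrix of the equation u' = - Gamma(c') u. *)
pose co (D : C0_connection E) p q t : R :=
  - \sum_x cdot t i 0 x * conn_coef D i j x p q (c t).
have ccoef (D0 : C0_connection E) x p q :
    {within `[a, b], continuous (fun t => conn_coef D0 i j x p q (c t))}.
  apply: (@within_continuous_comp_curve M R c (conn_coef D0 i j x p q)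
    `[a, b] (chart_dom i `&` triv_dom j) cc _ hij).
  exact: (@nabla_C0 _ _ _ _ _ _ D0 i j x p q).
have cdotx x : {within `[a, b], continuous (fun t => cdot t i 0 x)}.
  apply/subspace_continuousP => t tab.
  by have /subspace_continuousP/(_ t tab)/cvg_mxP/(_ 0 x) := ccd.
have cco (D0 : C0_connection E) p q : {within `[a, b], continuous (co D0 p q)}.
  apply/subspace_continuousP => t tab; apply: cvgN.
  apply: (@cvg_sumr _ _ _ _ (fun x t => cdot t i 0 x * conn_coef D0 i j x p q (c t))) => x.
  apply: (@cvgM R).
    by have /subspace_continuousP/(_ t tab) := cdotx x.
  by have /subspace_continuousP/(_ t tab) := ccoef D0 x p q.
have coE (D0 : C0_connection E) t v : t \in `[a, b] ->
    - (triv j (c t) (D0 (c t) (cdot t) (fun y => triv_inv j y v)) : 'rV[R]_l) =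
    \row_p \sum_q co D0 p q t * v 0 q.
  move=> tab; have [tX _] := hv t tab; have [it jt] := hij t tab.
  apply/rowP => p; rewrite !mxE (nabla_conn_coef _ _ _ _ _ _ D0 i j v _ _ p tX it jt).
  by rewrite -sumrN; apply: eq_bigr => q _; rewrite mulNr.
have [V V0 hV] := continuous_bounded_itv_family R _
  (fun x t => cdot t i 0 x) a b (ltW ab) cdotx.
have hco (e : R) : 0 < e -> \forall k \near F, forall p q t, t \in `[a, b] ->
    `|co (D_ k) p q t - co D p q t| <= e.
  (* Contraction with the velocity sums [m] terms, each with a factor bounded by [V], so
     coefficients within [e / C] suffice. The summand 1 keeps [C] positive. *)
  move=> e0; pose C := m%:R * V + 1.
  have C0 : 0 < C by rewrite ltr_wpDl// mulr_ge0.
  have cK : compact (c @` `[a, b]).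
    by apply: (@continuous_compact _ _ c `[a, b]%classic cc); exact: segment_compact.
  have Kij : c @` `[a, b] `<=` chart_dom i `&` triv_dom j.
    by move=> _ [t tab <-]; exact: hij.
  have := Foo _ (C0_converges_near D_ D i j _ _ DD cK Kij (divr_gt0 e0 C0)).
  apply: filterS => k hk p q t tab.
  rewrite /co opprK addrC -sumrB; under eq_bigr do rewrite -mulrBr.
  have hb x : `|conn_coef D i j x p q (c t) - conn_coef (D_ k) i j x p q (c t)| <= e / C.
    by rewrite distrC; apply: hk; exists t.
  apply: le_trans (ler_norm_sum_mul _ _ _ _ _ _ (fun x => hV x t tab) hb) _.
  rewrite mulrA; apply: le_trans (_ : C * (e / C) <= _).
    by rewrite ler_wpM2r ?lerDl// ltW// divr_gt0.
  by rewrite mulrCA mulfV ?mulr1// gt_eqF.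
have hu t : t \in `[a, b] -> has_deriv_within `[a, b]
    (fun t => triv j (c t) (s t) : 'rV[R]_l) t
    (\row_p \sum_q co D p q t * (triv j (c t) (s t) : 'rV[R]_l) 0 q).
  move=> tab; have [_ jt] := hij t tab.
  by have := hs t (cdot t) tab (hv t tab) j jt; rewrite linear0 sub0r coE.
have hva : (triv j (c a) (e_ k) : 'rV[R]_l) @[k --> F] --> (triv j (c a) (s a) : 'rV[R]_l).
  by apply/cvg_fibreP => //; case: (hij a aab).
have [u_ [u_a du_ u_b]] := linear_ode_family R F l a b (co D) (fun k => co (D_ k)) _
  (fun k => triv j (c a) (e_ k)) (ltW ab) (cco D) (fun k => cco (D_ k)) hco hu hva.
exists (fun k t => triv_inv j (c t) (u_ k t)); split.
- by move=> k; rewrite u_a trivK//; case: (hij a aab).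
- move=> k; split=> // r X rab vX j' j'r; rewrite linear0 sub0r.
  have XE := velocity_unique _ _ _ _ _ _ ab rab vX (hv r rab).
  have [tX hX] := vX; have [ir jr] := hij r rab.
  (* [cov_deriv] asks for the equation in every trivialization around the point, whereas [u_ k] was
     constructed to satisfy it in [j]. *)
  apply: (@cov_deriv_triv_change _ _ _ _ _ _ (D_ k) `[a, b] c _ r X i j j') => //.
  + by have /subspace_continuousP/(_ r rab) := cc.
  + exact: hX.
  + rewrite triv_invK// XE coE//.
    apply: has_deriv_within_eq (du_ k r rab); last by rewrite triv_invK.
    have H t : `[a, b]%classic t -> u_ k t = triv j (c t) (triv_inv j (c t) (u_ k t)).
      by move=> tab; rewrite triv_invK//; case: (hij t tab).
    exact: (@filterE _ _ (nbhs_filter r) _ H).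
- have [_ jb] := hij b bab.
  apply/(cvg_fibreP _ _ _ _ _ jb).
  by under eq_cvg do rewrite triv_invK//.
Qed.

(** Arbitrary convergent initial values are allowed, so that the end values over one interval can
    serve as initial values over the next. The sections for [D_ k] are parallel only piecewise, as
    the interval is cut to fit charts and trivializations. *)
Definition transport_continuous (F : set_system nat) (D_ : nat -> C0_connection E)
    (c : R -> M) (s : forall t, E (c t)) (a b : R) :=
  forall e_ : nat -> E (c a), cvg_fibre F (c a) e_ (s a) ->
  exists s_ : nat -> forall t, E (c t),
    [/\ forall k, s_ k a = e_ k, forall k, chain R (parallel_on (D_ k) c (s_ k)) a b &
        cvg_fibre F (c b) (fun k => s_ k b) (s b)].

Lemma transport_continuous_trans F D_ c s (x y z : R) : x < y -> y < z ->
  transport_continuous F D_ c s x y -> transport_continuous F D_ c s y z ->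
  transport_continuous F D_ c s x z.
Proof.
move=> xy yz hxy hyz e_ he.
have [s1 [s1x ps1 cs1]] := hxy e_ he.
have [s2 [s2y ps2 cs2]] := hyz _ cs1.
(* The two halves agree at [y] since [s2 k] starts at [s1 k y]; hence the glued section equals
   [s2 k] on all of the closed second half. *)
exists (fun k t => if t <= y then s1 k t else s2 k t); split.
- by move=> k; rewrite ltW.
- move=> k; apply: chain_trans (_ : chain _ _ x y) (_ : chain _ _ y z).
    apply: chain_imp (ps1 k) => a b xa ab by_; apply: parallel_on_eq => t.
    by rewrite in_itv/= => /andP[_ tb]; rewrite (le_trans tb by_).
  apply: chain_imp (ps2 k) => a b ya ab bz; apply: parallel_on_eq => t.
  rewrite in_itv/= => /andP[at_ _]; have yt := le_trans ya at_.
  case: ifPn => // ty; have tE : t = y by apply/eqP; rewrite eq_le ty yt.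
  by rewrite tE s2y.
- by rewrite (lt_geF yz).
Qed.

Lemma parallel_on_transport_continuous (F : set_system nat) {FF : Filter F}
    (D_ : nat -> C0_connection E) (D : C0_connection E) (c : R -> M)
    (s : forall t, E (c t)) (a b : R) :
  F `=>` \oo -> C0_converges D_ D -> a < b -> parallel_on D c s a b ->
  transport_continuous F D_ c s a b.
Proof.
move=> Foo DD ab ps; apply: (interval_chain_ind R _ a b ab).
  by move=> x y z; exact: transport_continuous_trans.
move=> t tab.
have [i it] := @chart_cover _ _ _ A (c t).
have [j jt] := @triv_cover _ _ _ _ _ E (c t).
have [[cc _] _] := ps.
have nW : nbhs (c t) (chart_dom i `&` triv_dom j).
  by apply: filterI; apply: open_nbhs_nbhs; split=> //;
    [exact: chart_dom_open|exact: triv_dom_open].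
have /subspace_continuousP/(_ t tab) := cc => ct.
have hd : \forall r \near t, r \in `[a, b] -> chart_dom i (c r) /\ triv_dom j (c r) := ct _ nW.
have /nbhs_ballP[d d0 hd'] := hd.
exists d => // x y ax xy yb tx yt e_ he.
have [||s_ [h1 h2 h3]] := parallel_transport_local F D_ D c s x y i j e_ Foo DD xy _ _ he.
- exact: parallel_on_subset ax xy yb ps.
- move=> r; rewrite in_itv/= => /andP[xr ry]; apply: hd'.
    by rewrite -ball_normE /= ltr_norml; apply/andP; split; lra.
  by rewrite in_itv/= (le_trans ax xr) (le_trans ry yb).
by exists s_; split=> // k; exact: chain1.
Qed.

Lemma parallel_transport_continuous (F : set_system nat) {FF : Filter F}
    (D_ : nat -> C0_connection E) (D : C0_connection E) (c : R -> M)
    (s : forall t, E (c t)) (e_ : nat -> E (c 0)) :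
  F `=>` \oo -> C0_converges D_ D -> parallel D s -> cvg_fibre F (c 0) e_ (s 0) ->
  exists s_ : nat -> forall t, E (c t),
    [/\ forall k, s_ k 0 = e_ k, forall k, parallel (D_ k) (s_ k) &
        cvg_fibre F (c 1) (fun k => s_ k 1) (s 1)].
Proof.
move=> Foo DD /parallelP ps he.
have : transport_continuous F D_ c s 0 1.
  apply: chain_ind.
    by move=> x y z; exact: transport_continuous_trans.
  apply: chain_imp ps => x y _ xy _.
  exact: parallel_on_transport_continuous Foo DD xy.
move=> /(_ e_ he)[s_ [h1 h2 h3]]; exists s_; split=> // k.
exact/parallelP.
Qed.

End curves.

(** * Limits of orthonormal bases *)

Lemma cvg_det (R : realType) (T : Type) (F : set_system T) n
    (M_ : T -> 'M[R]_n) (M : 'M[R]_n) {FF : Filter F} :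
  (forall i j, M_ k i j @[k --> F] --> M i j) -> \det (M_ k) @[k --> F] --> \det M.
Proof.
move=> h; rewrite /determinant.
apply: cvg_big => [|s _]; first exact: add_continuous.
apply: (@cvgM R); first exact: cvg_cst.
by apply: cvg_big => [|i _]; [exact: mul_continuous|exact: h].
Qed.

Lemma cvg_adj (R : realType) (T : Type) (F : set_system T) n
    (M_ : T -> 'M[R]_n) (M : 'M[R]_n) i j {FF : Filter F} :
  (forall i j, M_ k i j @[k --> F] --> M i j) ->
  (\adj (M_ k)) i j @[k --> F] --> (\adj M) i j.
Proof.
move=> h; under eq_cvg do rewrite mxE; rewrite mxE.
apply: (@cvgM R); first exact: cvg_cst.
by apply: cvg_det => p q; under eq_cvg do rewrite !mxE; rewrite !mxE; exact: h.
Qed.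

Lemma cvg_mulmx (R : realType) (T : Type) (F : set_system T) a b c
    (M_ : T -> 'M[R]_(a, b)) (M : 'M[R]_(a, b))
    (N_ : T -> 'M[R]_(b, c)) (N : 'M[R]_(b, c)) i j {FF : Filter F} :
  (forall i j, M_ k i j @[k --> F] --> M i j) ->
  (forall i j, N_ k i j @[k --> F] --> N i j) ->
  (M_ k *m N_ k) i j @[k --> F] --> (M *m N) i j.
Proof.
move=> hM hN; under eq_cvg do rewrite mxE; rewrite mxE.
apply: (@cvg_sumr _ _ _ _ (fun r k => M_ k i r * N_ k r j)) => r.
by apply: (@cvgM R).
Qed.

(** The hypothesis gives B B^T G = 1. Multiplying by the adjugate of G yields det(G) B B^T = adj(G),
    whose diagonal is read off. Adjugate and determinant are polynomial in G, so bounds on B follow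
    from convergence of G. *)
Lemma congruence1_sum_sqr (R : realType) n (G B : 'M[R]_n) p : B^T *m G *m B = 1%:M ->
  (\sum_q B p q ^+ 2) * \det G = (\adj G) p p.
Proof.
move=> /mulmx1C; rewrite mulmxA => h.
have : B *m B^T *m G *m \adj G = \adj G by rewrite h mul1mx.
rewrite -mulmxA mul_mx_adj mul_mx_scalar => /matrixP/(_ p p) <-.
rewrite !mxE mulrC; congr (_ * _).
by apply: eq_bigr => q _; rewrite mxE expr2.
Qed.

(** The image filter has a cluster point in a compact segment. A cluster point of an ultrafilter is
    a limit, because a neighbourhood outside the filter would have its complement in the filter and
    fail to meet it. *)
Lemma bounded_ultra_cvg (R : realType) (T : Type) (F : set_system T) (f : T -> R) (K : R) :
  UltraFilter F -> (\forall k \near F, `|f k| <= K) -> exists r : R, f k @[k --> F] --> r.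
Proof.
move=> FU hK.
have FP : ProperFilter (f @ F) by apply: fmap_proper_filter; exact: ultra_proper.
have [|r [_ hr]] := @segment_compact R (- K) K (f @ F) FP.
  have : \forall k \near F, f k \in `[- K, K].
    by apply: filterS hK => k; rewrite in_itv/= ler_norml.
  exact.
exists r => B rB; have [//|nB] := in_ultra_setVsetC (f @^-1` B) FU.
have [y [yB By]] := hr (~` B) B nB rB.
by case: yB.
Qed.

(** * Bases of a fibre, Gram matrices and transfer between equal fibres *)

Section bases.
Variables (R : realType) (M : topologicalType) (m : nat) (A : C2_atlas R M m).
Variables (l : nat) (E : C1_bundle A l).
Implicit Types (y : M).

Lemma metric_suml (h : bundle_metric E) y (I : Type) (r : seq I) (f : I -> R)
    (v : I -> E y) w : h y (\sum_(q <- r) f q *: v q) w = \sum_(q <- r) f q * h y (v q) w.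
Proof.
by apply: (linear_form_sum _ _ (fun u => h y u w)) => a u v0; exact: metric_linear.
Qed.

Lemma metric_sumr (h : bundle_metric E) y (I : Type) (r : seq I) (f : I -> R)
    (v : I -> E y) w : h y w (\sum_(q <- r) f q *: v q) = \sum_(q <- r) f q * h y w (v q).
Proof. by rewrite metricC metric_suml; apply: eq_bigr => q _; rewrite metricC. Qed.

Lemma coord_basis_tnth y (b : l.-tuple (E y)) v : basis_of fullv b ->
  v = \sum_q coord b q v *: tnth b q.
Proof.
move=> hb; rewrite {1}(coord_basis hb (memvf v)); apply: eq_bigr => q _.
by rewrite (tnth_nth 0).
Qed.

Lemma coord_sum_tnth y (b : l.-tuple (E y)) (f : 'I_l -> R) p : basis_of fullv b ->
  coord b p (\sum_q f q *: tnth b q) = f p.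
Proof.
move=> hb; rewrite -[RHS](coord_sum_free f p (basis_free hb)).
by congr (coord b p _); apply: eq_bigr => q _; rewrite (tnth_nth 0).
Qed.

Lemma metricE (h : bundle_metric E) y (b : l.-tuple (E y)) v w : basis_of fullv b ->
  h y v w = \sum_r coord b r v * (\sum_s coord b s w * gram h b r s).
Proof.
move=> hb; rewrite {1}(coord_basis_tnth y b v hb) metric_suml; apply: eq_bigr => r _.
congr (_ * _); rewrite {1}(coord_basis_tnth y b w hb) metric_sumr.
by apply: eq_bigr => s _; rewrite mxE.
Qed.

(** Replaces coordinates in a basis that varies with [k] by values of the metric, whose limit is
    accessible. *)
Lemma coord_orthonormal (h : bundle_metric E) y (b : l.-tuple (E y)) v p :
  metric_orthonormal h b -> coord b p v = h y (tnth b p) v.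
Proof.
move=> [hb ob]; rewrite {2}(coord_basis_tnth y b v hb) metric_sumr (bigD1 p)//=.
rewrite ob eqxx mulr1 big1 ?addr0// => q qp.
by rewrite ob eq_sym (negbTE qp) mulr0.
Qed.

(** A kernel vector of the Gram matrix would be the coordinate vector of some nonzero [w] with
    [h y w w = 0]. *)
Lemma gram_unit (h : bundle_metric E) y (b : l.-tuple (E y)) : basis_of fullv b ->
  \det (gram h b) != 0.
Proof.
move=> hb; apply/negP => /det0P[v v0 vG].
pose w := \sum_q v 0 q *: tnth b q.
have w0 : w != 0.
  apply: contra_neq v0 => w0; apply/rowP => q.
  by rewrite -(coord_sum_tnth y b (fun q => v 0 q) q hb) -/w w0 linear0 mxE.
have := metric_gt0 h w0.
rewrite {1}/w metric_suml big1 ?ltxx// => q _.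
rewrite metric_sumr.
have := congr1 (fun u : 'rV_l => u 0 q) vG; rewrite !mxE => vGq.
rewrite [X in _ * X](_ : _ = 0) ?mulr0// -[RHS]vGq.
by apply: eq_bigr => r _; rewrite mxE metricC.
Qed.

Definition coord_mx y (b b' : l.-tuple (E y)) : 'M[R]_l :=
  \matrix_(p, q) coord b p (tnth b' q).

Lemma gram_coord_mx (h : bundle_metric E) y (b b' : l.-tuple (E y)) :
  basis_of fullv b -> gram h b' = (coord_mx y b b')^T *m gram h b *m coord_mx y b b'.
Proof.
move=> hb; apply/matrixP => p q; rewrite -mulmxA !mxE (metricE h y b _ _ hb).
apply: eq_bigr => r _; rewrite !mxE; congr (_ * _).
by apply: eq_bigr => s _; rewrite !mxE mulrC.
Qed.

Lemma orthonormal_gram (h : bundle_metric E) y (b : l.-tuple (E y)) :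
  metric_orthonormal h b <-> basis_of fullv b /\ gram h b = 1%:M.
Proof.
split=> -[hb H]; split=> //; first by apply/matrixP => p q; rewrite !mxE H.
by move=> p q; move/matrixP/(_ p q) : H; rewrite !mxE.
Qed.

Lemma unit_coord_mx_basis y (b b' : l.-tuple (E y)) : basis_of fullv b ->
  \det (coord_mx y b b') != 0 -> basis_of fullv b'.
Proof.
move=> hb hd; rewrite basisEfree subvf size_tuple (size_basis hb) leqnn !andbT.
apply/freeP => k hk q.
have : coord_mx y b b' *m (\col_q k q) = 0.
  apply/matrixP => p i; rewrite !mxE.
  transitivity (coord b p (\sum_(i < l) k i *: b'`_i)); last by rewrite hk linear0.
  rewrite linear_sum; apply: eq_bigr => r _; rewrite linearZ !mxE mulrC.
  by rewrite (tnth_nth 0).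
move=> /(congr1 (mulmx (invmx (coord_mx y b b')))).
rewrite mulKmx ?mulmx0; last by rewrite unitmxE unitfE.
by move=> /matrixP/(_ q 0); rewrite !mxE.
Qed.

(* For a loop c at x, the equalities c 0 = x and c 1 = x are propositional. *)
Definition cast_fibre y z (h : y = z) : E y -> E z :=
  match h in _ = z return E y -> E z with erefl => id end.

Lemma Tagged_cast_fibre y z (h : y = z) e :
  Tagged (fibre E) (cast_fibre y z h e) = Tagged (fibre E) e.
Proof. by case: z / h. Qed.

(** Equality in the total space comes with its own equality of base points. After elimination of [h]
    this is a proof of [y = y], which is identified with [erefl]. *)
Lemma cast_fibre_Tagged y z (h : y = z) (e : E y) (e' : E z) :
  Tagged (fibre E) e' = Tagged (fibre E) e -> e' = cast_fibre y z h e.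
Proof.
case: z / h e' => e' /= H.
have := projT2_eq H; rewrite (_ : projT1_eq H = erefl)//.
Qed.

Lemma cvg_cast_fibre (F : set_system nat) y z (h : y = z) e_ e :
  cvg_fibre _ _ _ _ _ E F y e_ e ->
  cvg_fibre _ _ _ _ _ E F z (fun k => cast_fibre y z h (e_ k)) (cast_fibre y z h e).
Proof. by case: z / h. Qed.

End bases.

Theorem theorem1p1 (R : realType) (M : topologicalType) (m : nat)
    (A : C2_atlas R M m)
    (M_hausdorff : hausdorff_space M)
    (M_second_countable : @second_countable M)
    (M_connected : connected [set: M])
    (x : M) (l : nat) (E : C1_bundle A l) (o : orientation E)
    (g : bundle_metric E) (D : C0_connection E)
    (D_g : compatible D g)
    (g_ : nat -> bundle_metric E) (D_ : nat -> C0_connection E)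
    (D_g_ : forall k, compatible (D_ k) (g_ k))
    (g_cvg : forall b : l.-tuple (E x), basis_of fullv b ->
       (fun k => gram (g_ k) b) @ \oo --> gram g b)
    (D_cvg : C0_converges D_ D)
    (H : set 'M[R]_l) (H_SO : H `<=` SO R l) (H_closed : closed H)
    (Hol_H : forall k, exists b : l.-tuple (E x),
       [/\ positively_oriented o b, metric_orthonormal (g_ k) b &
           forall P, Hol (D_ k) x P -> H (mx_in_basis b P)]) :
  exists b : l.-tuple (E x),
    [/\ positively_oriented o b, metric_orthonormal g b &
        forall P, Hol D x P -> H (mx_in_basis b P)].
Proof.
have [b_ hb_] := choice Hol_H.
pose b0 := b_ 0%N.
have [po0 [hb0 _] _] := hb_ 0%N.
rewrite -/b0 in po0 hb0.
have [F [FU Foo]] := ultraFilterLemma eventually_filter.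
have FP : ProperFilter F by exact: ultra_proper.
have FF : Filter F by exact: filter_filter.
pose B_ k := coord_mx _ _ _ _ _ E x b0 (b_ k).
have hG p q : gram (g_ k) b0 p q @[k --> F] --> gram g b0 p q.
  have /cvg_mxP/(_ p q) := g_cvg b0 hb0.
  by apply: cvg_trans; apply: cvg_app.
have BGB k : (B_ k)^T *m gram (g_ k) b0 *m B_ k = 1%:M.
  have [_ /orthonormal_gram[_ <-] _] := hb_ k.
  by rewrite -gram_coord_mx.
have detG0 : \det (gram g b0) != 0 by exact: gram_unit.
(* B_k B_k^T is the inverse of the Gram matrix of g_k in b0, so B_k is bounded. *)
have [B hB] : exists B : 'M[R]_l, forall p q, B_ k p q @[k --> F] --> B p q.
  have : forall pq : 'I_l * 'I_l, exists r : R, B_ k pq.1 pq.2 @[k --> F] --> r.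
    move=> [p q] /=.
    have cdet : \det (gram (g_ k) b0) @[k --> F] --> \det (gram g b0) by exact: cvg_det.
    have cq : (\adj (gram (g_ k) b0)) p p / \det (gram (g_ k) b0) @[k --> F] -->
        (\adj (gram g b0)) p p / \det (gram g b0).
      by apply: (@cvgM R); [exact: cvg_adj|exact: cvgV].
    have dn : \forall k \near F, \det (gram (g_ k) b0) != 0 by apply: cvgr_neq0 cdet detG0.
    pose L := (\adj (gram g b0)) p p / \det (gram g b0).
    have /cvgrPdist_le/(_ 1 ltr01) := cq; rewrite -/L => cL.
    (* Eventually the square of an entry is at most [L + 1], since [L] is the limit of the sum of
       squares of its row. Then 2|r| <= r^2 + 1 bounds the entry by [L + 2]. *)
    apply: (@bounded_ultra_cvg _ _ _ _ (L + 2)).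
    apply: filterS2 cL dn => k hk dk.
    rewrite -(congruence1_sum_sqr R _ _ _ p (BGB k)) mulfK// in hk.
    have : B_ k p q ^+ 2 <= \sum_q B_ k p q ^+ 2.
      by rewrite [leRHS](bigD1 q)//= lerDl sumr_ge0// => r _; exact: sqr_ge0.
    move: hk; rewrite ler_distlC => /andP[hk1 hk2] hk3.
    have : `|B_ k p q| ^+ 2 <= L + 1 by rewrite real_normK ?num_real; lra.
    by have := normr_ge0 (B_ k p q); have := sqr_ge0 (`|B_ k p q| - 1); rewrite sqrrB1 mulr2n; lra.
  by move=> /choice[r hr]; exists (\matrix_(p, q) r (p, q)) => p q; rewrite mxE; exact: hr (p, q).
(* This identity gives both the orthonormality of the limit basis and the invertibility of [B]. *)
have BGB1 : B^T *m gram g b0 *m B = 1%:M.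
  have hT p q : (B_ k)^T p q @[k --> F] --> B^T p q.
    by under eq_cvg do rewrite mxE; rewrite mxE; exact: hB.
  apply/matrixP => p q.
  have c1 : ((B_ k)^T *m gram (g_ k) b0 *m B_ k) p q @[k --> F] -->
      (B^T *m gram g b0 *m B) p q.
    by apply: cvg_mulmx hB => r s; exact: cvg_mulmx hT hG.
  have c2 : ((B_ k)^T *m gram (g_ k) b0 *m B_ k) p q @[k --> F] --> (1%:M : 'M[R]_l) p q.
    by under eq_cvg do rewrite BGB; exact: cvg_cst.
  exact: cvg_unique c1 c2.
have detB0 : \det B != 0.
  have := congr1 determinant BGB1; rewrite det1 !det_mulmx => dB.
  by apply: contra_eq_neq dB => ->; rewrite mulr0 eq_sym oner_neq0.
pose b : l.-tuple (E x) := [tuple \sum_p B p q *: tnth b0 p | q < l].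
have bE q : tnth b q = \sum_p B p q *: tnth b0 p by rewrite tnth_mktuple.
have BE : coord_mx _ _ _ _ _ E x b0 b = B.
  by apply/matrixP => p q; rewrite mxE bE coord_sum_tnth.
have hb : basis_of fullv b by apply: (unit_coord_mx_basis _ _ _ _ _ _ _ _ _ hb0); rewrite BE.
have ob : metric_orthonormal g b.
  by apply/orthonormal_gram; split=> //; rewrite (gram_coord_mx _ _ _ _ _ _ _ _ b0)// BE.
exists b; split=> //.
  (* The determinants of the [B_ k] are positive, so that of [B] is nonnegative; being nonzero, it
     is positive. *)
  apply/(positively_oriented_det po0 hb); rewrite -/(coord_mx _ _ _ _ _ E x b0 b) BE.
  rewrite lt_neqAle eq_sym detB0 /=.
  have cdet : \det (B_ k) @[k --> F] --> \det B by exact: cvg_det.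
  apply: (@closed_cvg _ _ _ _ _ (fun r : R => 0 <= r) (@closed_ge R 0) _ _ cdet).
  apply: (@filterE _ F) => k; have [pok [hbk _] _] := hb_ k.
  by have /(positively_oriented_det po0 hbk)/ltW := pok.
move=> P [c [pc c0 c1 tP]].
have cb q : cvg_fibre _ _ _ _ _ E F x (fun k => tnth (b_ k) q) (tnth b q).
  move=> phi phiL.
  have phiS (f : 'I_l -> R) : phi (\sum_p f p *: tnth b0 p) = \sum_p f p * phi (tnth b0 p).
    exact: linear_form_sum.
  rewrite bE phiS.
  under eq_cvg do rewrite (coord_basis_tnth _ _ _ _ _ _ x b0 (tnth (b_ _) q) hb0) phiS.
  apply: (@cvg_sumr _ _ _ _ (fun p k => coord b0 p (tnth (b_ k) q) * phi (tnth b0 p))) => p.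
  apply: (@cvgM R); last exact: cvg_cst.
  by have := hB p q; under eq_cvg do rewrite mxE.
pose to0 := cast_fibre _ _ _ _ _ E x (c 0) (esym c0).
pose from1 := cast_fibre _ _ _ _ _ E (c 1) x c1.
(* The section witnessing [P e] is followed by parallel sections for the [D_ k] with initial values
   [e_ k], and [P e] is the limit of their end values. *)
have lift (e_ : nat -> E x) (e : E x) : cvg_fibre _ _ _ _ _ E F x e_ e ->
    exists s_ : nat -> forall t, E (c t),
      [/\ forall k, s_ k 0 = to0 (e_ k), forall k, parallel (D_ k) (s_ k) &
          cvg_fibre _ _ _ _ _ E F x (fun k => from1 (s_ k 1)) (P e)].
  move=> he; have [s [ps s0 s1]] := tP e.
  have s0E : s 0 = to0 e by exact: cast_fibre_Tagged.
  have s1E : P e = from1 (s 1) by apply: cast_fibre_Tagged; rewrite s1.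
  have he0 : cvg_fibre _ _ _ _ _ E F (c 0) (fun k => to0 (e_ k)) (s 0).
    by rewrite s0E; exact: cvg_cast_fibre.
  have [s_ [h1 h2 h3]] := parallel_transport_continuous _ _ _ _ _ _ F D_ D c s _ Foo D_cvg ps he0.
  by exists s_; split=> //; rewrite s1E; exact: cvg_cast_fibre.
have /choice[S hS] q := lift _ _ (cb q).
(* The sections [S q k] form a convergent family for each [q], and [Pk] must take precisely their
   end values on the basis. This is consistent because the vectors of a basis are distinct. For any
   other [e], [lift] applied to the constant sequence [e] supplies a parallel section. *)
have exP k : exists Pk : E x -> E x, is_transport (D_ k) c Pk /\
    forall q, Pk (tnth (b_ k) q) = from1 (S q k 1).
  have : forall e : E x, exists w : E x, (exists s : forall t, E (c t),
      [/\ parallel (D_ k) s, s 0 = to0 e & w = from1 (s 1)]) /\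
      forall q, e = tnth (b_ k) q -> w = from1 (S q k 1).
    move=> e; have [_ [hbk _] _] := hb_ k.
    have [[q eq]|ne] := pselect (exists q, e = tnth (b_ k) q).
      exists (from1 (S q k 1)); split.
        by exists (S q k); have [h1 h2 _] := hS q; rewrite eq.
      move=> q' eq'; have -> // : q = q'.
      apply/eqP; have := congr1 (coord (b_ k) q) (etrans (esym eq) eq').
      rewrite !(tnth_nth 0) !coord_free ?(basis_free hbk)// eqxx.
      by case: eqVneq => // _ /eqP; rewrite oner_eq0.
    have cst_cvg : cvg_fibre _ _ _ _ _ E F x (fun=> e) e.
      by move=> phi _; exact: cvg_cst.
    have [s_ [h1 h2 _]] := lift _ _ cst_cvg.
    exists (from1 (s_ k 1)); split; first by exists (s_ k).
    by move=> q eq; case: ne; exists q.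
  move=> /choice[Pk hPk]; exists Pk; split; last by move=> q; exact: (hPk _).2.
  move=> e; have [[s [ps s0 ->]] _] := hPk e; exists s; split=> //.
    by rewrite s0 Tagged_cast_fibre.
  by rewrite Tagged_cast_fibre.
have /choice[P_ hP_] := exP.
have HP k : H (mx_in_basis (b_ k) (P_ k)).
  have [_ _ hH] := hb_ k; apply: hH.
  by exists c; split=> //; case: (hP_ k).
apply: (@closed_cvg _ _ F FP (fun k => mx_in_basis (b_ k) (P_ k)) H H_closed).
  exact: (@filterE _ F).
(* Both the limit entry and the approximating entries become metric values, expanded in the fixed
   basis [b0]. What is left are finite sums of products of convergent factors. *)
apply/cvg_mxP => p q; rewrite mxE (coord_orthonormal _ _ _ _ _ _ _ _ _ _ _ ob).
rewrite (metricE _ _ _ _ _ _ _ _ b0)//.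
have E1 k : mx_in_basis (b_ k) (P_ k) p q =
    \sum_r B_ k r p * (\sum_s coord b0 s (from1 (S q k 1)) * gram (g_ k) b0 r s).
  have [_ obk _] := hb_ k; have [_ hPq] := hP_ k.
  rewrite mxE (coord_orthonormal _ _ _ _ _ _ _ _ _ _ _ obk) hPq.
  rewrite (metricE _ _ _ _ _ _ _ _ b0)//.
  by apply: eq_bigr => r _; rewrite mxE.
under eq_cvg do rewrite E1.
apply: (@cvg_sumr _ _ _ _ (fun r k => B_ k r p *
  (\sum_s coord b0 s (from1 (S q k 1)) * gram (g_ k) b0 r s))) => r.
have -> : coord b0 r (tnth b p) = B r p by rewrite -BE mxE.
apply: (@cvgM R); first exact: hB.
apply: (@cvg_sumr _ _ _ _ (fun s k => coord b0 s (from1 (S q k 1)) * gram (g_ k) b0 r s)) => s.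
apply: (@cvgM R); last exact: hG.
have [_ _ hSq] := hS q.
by apply: (hSq (coord b0 s)) => a u v; rewrite linearP.
Qed.
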